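(* For every $\Sigma^1_1$ set $P \subseteq \mathbb{N}$ there exist a finite alphabet $S$ and a cellular automaton $f$ on the full shift $S^{\mathbb{Z}}$ such that $P$ is many-one reducible to the language of the asymptotic set $\mathcal{A}(f)$. In particular, there exists a cellular automaton on a full shift whose asymptotic set has a $\Sigma^1_1$-complete language.
   Context: A cellular automaton on $X = S^{\mathbb{Z}}$ ($S$ finite, product topology) is a continuous map $f: X\to X$ commuting with the shift. The asymptotic set of $f$ is $\mathcal{A}(f) = \bigcup_{x \in X} \bigcap_{n \in \mathbb{N}} \overline{\bigcup_{k \geq n} \{f^k(x)\}}$. The language of a (not necessarily closed) set $Y \subseteq S^{\mathbb{Z}}$ is the set of words $w \in S^*$ with $w = y_{[0,k-1]}$ for some $y \in Y$, $k \in \mathbb{N}$; it is viewed as a subset of $\mathbb{N}$ via a computable bijection $S^* \cong \mathbb{N}$. A set $P \subseteq \mathbb{N}$ is $\Sigma^1_1$ if $w \in P \iff (\exists C \subseteq \mathbb{N})(\forall m \in \mathbb{N})(\exists \ell \in \mathbb{N}) R(C,m,\ell,w)$ for some recursive predicate $R$; it is $\Sigma^1_1$-complete if it is $\Sigma^1_1$ and every $\Sigma^1_1$ set many-one (computably) reduces to it. *)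

(* Defs.v *)
From Stdlib Require Import ZArith.
From mathcomp Require Import all_boot.
Set Implicit Arguments. Unset Strict Implicit. Unset Printing Implicit Defensive.

(* Arguments are given as a list of naturals; missing arguments read as 0. *)
Inductive rfun : Type :=
| RZero
| RSucc
| RProj (i : nat)
| ROracle
| RComp (g : rfun) (hs : list rfun)
| RPrimRec (b s : rfun)
| RMu (g : rfun).

Inductive reval (C : nat -> bool) : rfun -> seq nat -> nat -> Prop :=
| ev_zero v : reval C RZero v 0
| ev_succ v : reval C RSucc v (head 0 v).+1
| ev_proj i v : reval C (RProj i) v (nth 0 v i)
| ev_oracle v : reval C ROracle v (if C (head 0 v) then 1 else 0)
| ev_comp g hs v ws r :
    revals C hs v ws -> reval C g ws r -> reval C (RComp g hs) v r
| ev_rec0 b s v r : reval C b v r -> reval C (RPrimRec b s) (0 :: v) r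
| ev_recS b s n v a r :
    reval C (RPrimRec b s) (n :: v) a -> reval C s (n :: a :: v) r ->
    reval C (RPrimRec b s) (n.+1 :: v) r
| ev_recnil b s r : reval C (RPrimRec b s) [:: 0] r ->
    reval C (RPrimRec b s) [::] r
| ev_mu g v n :
    reval C g (n :: v) 0 ->
    (forall m, m < n -> exists2 r, reval C g (m :: v) r & r <> 0) ->
    reval C (RMu g) v n
with revals (C : nat -> bool) : list rfun -> seq nat -> seq nat -> Prop :=
| evs_nil v : revals C nil v [::]
| evs_cons h hs v w ws :
    reval C h v w -> revals C hs v ws -> revals C (cons h hs) v (w :: ws).

Definition computable (g : nat -> nat) : Prop :=
  exists e : rfun, forall n, reval (fun _ => false) e [:: n] (g n).

Definition many_one_reducible (P Q : nat -> Prop) : Prop :=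
  exists g, computable g /\ forall w, P w <-> Q (g w).

(* Sigma^1_1: w \in P <-> exists C, forall m, exists l, R(C,m,l,w), with R
   a recursive predicate (an oracle program total for every oracle; R holds
   iff the output is 0). *)
Definition Sigma11 (P : nat -> Prop) : Prop :=
  exists e : rfun,
    (forall (C : nat -> bool) m l w, exists r, reval C e [:: m; l; w] r) /\
    (forall w, P w <-> exists C : nat -> bool, forall m, exists l,
        reval C e [:: m; l; w] 0).

Definition Sigma11_complete (P : nat -> Prop) : Prop :=
  Sigma11 P /\ forall Q, Sigma11 Q -> many_one_reducible Q P.

Definition config (S : Type) := Z -> S.

Definition shift (S : Type) (x : config S) : config S := fun i => x (i + 1)%Z.

Definition agree_on (S : Type) (m : nat) (x y : config S) : Prop :=
  forall i : Z, (Z.abs i <= Z.of_nat m)%Z -> x i = y i.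

(* continuity for the product topology on S^Z (S discrete) *)
Definition cont_prod (S : Type) (f : config S -> config S) : Prop :=
  forall (x : config S) (n : nat), exists m : nat,
    forall y : config S, agree_on m y x -> agree_on n (f y) (f x).

Definition cellular_automaton (S : Type) (f : config S -> config S) : Prop :=
  cont_prod f /\ forall x i, f (shift x) i = shift (f x) i.

(* y lies in the omega-limit set of x: for all n, y is in the closure of
   {f^k x | k >= n} *)
Definition omega_limit (S : Type) (f : config S -> config S) (x y : config S)
  : Prop :=
  forall n m : nat, exists k : nat, n <= k /\ agree_on m (iter k f x) y.

Definition asymptotic_set (S : Type) (f : config S -> config S) (y : config S)
  : Prop := exists x, omega_limit f x y.

Definition language (S : Type) (Y : config S -> Prop) (w : seq S) : Prop :=
  exists y, Y y /\ w = map (fun i => y (Z.of_nat i)) (iota 0 (size w)).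

(* computable bijection S^* ~ N: bijective base-#|S| numeration,
   letter a has digit (enum_rank a).+1, least significant digit first *)
Fixpoint word_code (S : finType) (w : seq S) : nat :=
  match w with
  | [::] => 0
  | a :: w' => (enum_rank a).+1 + #|S| * word_code w'
  end.

Definition languageN (S : finType) (Y : config S -> Prop) (n : nat) : Prop :=
  exists w : seq S, word_code w = n /\ language Y w.

(* Main.v *)
Require Import Defs.
From Stdlib Require Import ZArith FunctionalExtensionality ClassicalEpsilon IndefiniteDescription.
From mathcomp Require Import all_boot zify.
Set Implicit Arguments. Unset Strict Implicit. Unset Printing Implicit Defensive.

(** By compactness, a word u is in the language of the asymptotic set of f iff u occurs at
    the origin of f^k(x) for infinitely many k, for some x.

    Given P = {w | exists C, forall m, exists l, R(C,m,l,w)}, a counter machine with oracle C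
    repeatedly tests whether every m' <= m has a witness l' <= l; it increments m on success
    and l on failure. Hence it succeeds infinitely often iff w is in P, whatever the initial
    values of m and l. A radius-1 automaton runs this machine on the half-line to the right of
    a wall: register i is the position of the first 0 on track i, C is a read-only track, and
    one head walks between the wall and these positions. The window word consists of the wall
    with the head in its initial state followed by w + 1 cells; on it the input track is
    1^(w+1) 0 and every other track is constantly 1, which after a success is true because all
    other registers are then at least w + 2. The content of x to the right of the window only
    provides the oracle and initial register values, so it cannot do any harm, except through
    other heads; these are kept out because each cell records on which side its head is.

    Conversely, rows of a space-time diagram are coded by numbers in base #|S|, which puts the
    language of any radius-1 automaton in Sigma^1_1, uniformly in the table of its local rule.
    This uniformity makes the set of pairs (table, word) universal, and the first construction
    applied to it yields an automaton with a complete language. *)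

(** * Total recursive functionals *)


(** [F] is a plain function of oracle and argument list, so closure lemmas replace the writing of
    programs. The length of [v] is fixed so that finitely many projections can rebuild [v]. *)
Definition trec (n : nat) (F : (nat -> bool) -> seq nat -> nat) : Prop :=
  exists e, forall C v, size v = n -> reval C e v (F C v).

Fixpoint trecs n (Hs : seq ((nat -> bool) -> seq nat -> nat)) : Prop :=
  if Hs is H :: Hs' then trec n H /\ trecs n Hs' else True.

Lemma trec_ext n F G :
  (forall C v, size v = n -> F C v = G C v) -> trec n F -> trec n G.
Proof. by move=> FG [e He]; exists e => C v sv; rewrite -FG //; apply: He. Qed.

Lemma trecs_revals n Hs : trecs n Hs -> exists hs, forall C v, size v = n ->
  revals C hs v [seq H C v | H <- Hs].
Proof.
elim: Hs => [_|H Hs IH [[h Hh] /IH [hs Hhs]]].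
  by exists nil => C v _; apply: evs_nil.
by exists (cons h hs) => C v sv; apply: evs_cons; [apply: Hh | apply: Hhs].
Qed.

Lemma trec_comp n G Hs : trec (size Hs) G -> trecs n Hs ->
  trec n (fun C v => G C [seq H C v | H <- Hs]).
Proof.
move=> [g Hg] /trecs_revals [hs Hhs]; exists (RComp g hs) => C v sv.
by apply: ev_comp; [apply: Hhs | apply: Hg; rewrite size_map].
Qed.

Lemma trec_comp1 n G F : trec 1 G -> trec n F -> trec n (fun C v => G C [:: F C v]).
Proof. by move=> HG HF; apply: (@trec_comp n G [:: F]). Qed.

Lemma trec_comp2 n G F1 F2 : trec 2 G -> trec n F1 -> trec n F2 ->
  trec n (fun C v => G C [:: F1 C v; F2 C v]).
Proof. by move=> HG H1 H2; apply: (@trec_comp n G [:: F1; F2]). Qed.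

Lemma trec_comp3 n G F1 F2 F3 : trec 3 G -> trec n F1 -> trec n F2 -> trec n F3 ->
  trec n (fun C v => G C [:: F1 C v; F2 C v; F3 C v]).
Proof. by move=> HG H1 H2 H3; apply: (@trec_comp n G [:: F1; F2; F3]). Qed.

(** Bound variables are pushed onto the front of the list, so under [j] binders the outer arguments
    appear as [iter j behead v], up to conversion. *)
Lemma trec_nth n j k : trec n (fun _ v => nth 0 (iter j behead v) k).
Proof.
exists (RProj (j + k)) => C v _.
suff -> : nth 0 (iter j behead v) k = nth 0 v (j + k) by apply: ev_proj.
by elim: j k => //= j IH k; rewrite nth_behead IH addnS.
Qed.

Lemma trec_const n c : trec n (fun _ _ => c).
Proof.
elim: c => [|c [e He]]; first by exists RZero => C v _; apply: ev_zero.
exists (RComp RSucc (cons e nil)) => C v sv; apply: (@ev_comp _ _ _ _ [:: c]).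
  by apply: evs_cons; [apply: He | apply: evs_nil].
exact: (ev_succ _ [:: c]).
Qed.

Lemma trec_succ n F : trec n F -> trec n (fun C v => (F C v).+1).
Proof.
move=> HF; apply: (@trec_comp1 n (fun _ v => (head 0 v).+1)) => //.
by exists RSucc => C v _; apply: ev_succ.
Qed.

Lemma trec_oracle n F : trec n F -> trec n (fun C v => C (F C v) : nat).
Proof.
move=> HF; apply: (@trec_ext _ (fun C v => if C (F C v) then 1 else 0)) => [C v _|].
  by case: (C _).
apply: (@trec_comp1 n (fun C v => if C (head 0 v) then 1 else 0)) => //.
by exists ROracle => C v _; apply: ev_oracle.
Qed.

Lemma trecs_iota n k m : trecs n [seq (fun (_ : nat -> bool) v => nth 0 v i) | i <- iota k m].
Proof.
by elim: m k => //= m IH k; split; [exact: (trec_nth n 0) | exact: IH].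
Qed.

Lemma trec_subst n F H : trec n.+1 (fun C w => F C (nth 0 w 0) (behead w)) -> trec n H ->
  trec n (fun C v => F C (H C v) v).
Proof.
move=> HF HH.
pose Hv := H :: [seq (fun (_ : nat -> bool) v => nth 0 v i) | i <- iota 0 n].
have := @trec_comp n (fun C w => F C (nth 0 w 0) (behead w)) Hv.
rewrite {1}/Hv /= size_map size_iota => /(_ HF).
move=> H1; apply: trec_ext (H1 _); last by split=> //; apply: trecs_iota.
move=> C v sv; rewrite /=.
suff -> : [seq H C v | H <- [seq (fun=> nth 0^~ i) | i <- iota 0 n]] = v by [].
by rewrite -map_comp -sv; apply: (@mkseq_nth _ 0).
Qed.

Lemma trec_iteri n N B S : trec n N -> trec n B ->
  trec n.+2 (fun C w => S C (nth 0 w 0) (nth 0 w 1) (behead (behead w))) ->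
  trec n (fun C v => iteri (N C v) (fun i a => S C i a v) (B C v)).
Proof.
move=> HN [b Hb] [s Hs].
apply: (@trec_subst _ (fun C m v => iteri m (fun i a => S C i a v) (B C v))) HN.
exists (RPrimRec b s) => C [|m v] //= [sv].
elim: m => [|m IH] /=; first by apply/ev_rec0/Hb.
by apply: (ev_recS IH); apply: (Hs C [:: _, _ & _]); rewrite /= sv.
Qed.

Ltac trec_leaf := solve [ assumption | exact: trec_const | exact: (trec_nth _ 0)
  | exact: (trec_nth _ 1) | exact: (trec_nth _ 2) | exact: (trec_nth _ 3)
  | exact: (trec_nth _ 4) ].

Lemma trec_add n F G : trec n F -> trec n G -> trec n (fun C v => F C v + G C v).
Proof.
move=> HF HG; apply: (@trec_comp2 n (fun _ v => nth 0 v 0 + nth 0 v 1)) => //.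
apply: (@trec_ext _ (fun _ v => iteri (nth 0 v 0) (fun _ a => a.+1) (nth 0 v 1))).
  by move=> _ v _; elim: (nth 0 v 0) => //= m ->.
by apply: trec_iteri; try apply: trec_succ; trec_leaf.
Qed.

Lemma trec_mul n F G : trec n F -> trec n G -> trec n (fun C v => F C v * G C v).
Proof.
move=> HF HG; apply: (@trec_comp2 n (fun _ v => nth 0 v 0 * nth 0 v 1)) => //.
apply: (@trec_ext _ (fun _ v => iteri (nth 0 v 0) (fun _ a => nth 0 v 1 + a) 0)).
  by move=> _ v _; elim: (nth 0 v 0) => //= m ->; rewrite mulSn.
by apply: (@trec_iteri _ _ _ (fun _ _ a v => nth 0 v 1 + a)); try apply: trec_add; trec_leaf.
Qed.

Lemma trec_exp n F G : trec n F -> trec n G -> trec n (fun C v => F C v ^ G C v).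
Proof.
move=> HF HG; apply: (@trec_comp2 n (fun _ v => nth 0 v 0 ^ nth 0 v 1)) => //.
apply: (@trec_ext _ (fun _ v => iteri (nth 0 v 1) (fun _ a => nth 0 v 0 * a) 1)).
  by move=> _ v _; elim: (nth 0 v 1) => //= m ->; rewrite expnS.
by apply: (@trec_iteri _ _ _ (fun _ _ a v => nth 0 v 0 * a)); try apply: trec_mul; trec_leaf.
Qed.

Lemma trec_pred n F : trec n F -> trec n (fun C v => (F C v).-1).
Proof.
move=> HF; apply: (@trec_comp1 n (fun _ v => (nth 0 v 0).-1)) => //.
apply: (@trec_ext _ (fun _ v => iteri (nth 0 v 0) (fun i _ => i) 0)).
  by move=> _ v _; case: (nth 0 v 0).
by apply: trec_iteri; trec_leaf.
Qed.

Lemma trec_sub n F G : trec n F -> trec n G -> trec n (fun C v => F C v - G C v).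
Proof.
move=> HF HG; apply: (@trec_comp2 n (fun _ v => nth 0 v 0 - nth 0 v 1)) => //.
apply: (@trec_ext _ (fun _ v => iteri (nth 0 v 1) (fun _ a => a.-1) (nth 0 v 0))).
  by move=> _ v _; elim: (nth 0 v 1) => [|m /= ->]; rewrite ?subn0 // subnS.
by apply: trec_iteri; try apply: trec_pred; trec_leaf.
Qed.

(** The step of [trec_iteri] also receives the accumulator, at position 1; a summand that ignores it
    is composed with all projections but that one. *)
Lemma trec_weak n F : trec n.+1 (fun C w => F C (nth 0 w 0) (behead w)) ->
  trec n.+2 (fun C w => F C (nth 0 w 0) (behead (behead w))).
Proof.
move=> HF.
pose Hv := [seq (fun (_ : nat -> bool) v => nth 0 v i) | i <- 0 :: iota 2 n].
have := @trec_comp n.+2 (fun C w => F C (nth 0 w 0) (behead w)) Hv.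
rewrite {1}/Hv size_map /= size_iota => /(_ HF) H; apply: trec_ext (H _); last first.
  by split; [exact: (trec_nth _ 0) | apply: trecs_iota].
move=> C [|a [|b v]] //= [sv].
suff -> : [seq H C [:: a, b & v] | H <- [seq (fun=> nth 0^~ i) | i <- iota 2 n]] = v by [].
by rewrite -map_comp -sv (iotaDl 2 0) -map_comp -[RHS](@mkseq_nth _ 0).
Qed.

Lemma trec_sum n N F : trec n N -> trec n.+1 (fun C w => F C (nth 0 w 0) (behead w)) ->
  trec n (fun C v => \sum_(i < N C v) F C i v).
Proof.
move=> HN HF; apply: (@trec_ext _ (fun C v => iteri (N C v) (fun i a => a + F C i v) 0)).
  by move=> C v _; elim: (N C v) => [|m /= ->]; rewrite ?big_ord0 // big_ord_recr.
apply: (@trec_iteri _ _ _ (fun C i a v => a + F C i v)) => //; first trec_leaf.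
by apply: trec_add; [trec_leaf | apply: trec_weak].
Qed.

Lemma trec_prod n N F : trec n N -> trec n.+1 (fun C w => F C (nth 0 w 0) (behead w)) ->
  trec n (fun C v => \prod_(i < N C v) F C i v).
Proof.
move=> HN HF; apply: (@trec_ext _ (fun C v => iteri (N C v) (fun i a => a * F C i v) 1)).
  by move=> C v _; elim: (N C v) => [|m /= ->]; rewrite ?big_ord0 // big_ord_recr.
apply: (@trec_iteri _ _ _ (fun C i a v => a * F C i v)) => //; first trec_leaf.
by apply: trec_mul; [trec_leaf | apply: trec_weak].
Qed.

Lemma sum_ltn n d : d <= n -> \sum_(i < n) (i < d : nat) = d.
Proof.
elim: n d => [|n IH] d; first by rewrite big_ord0; case: d.
rewrite big_ord_recr leq_eqVlt => /predU1P[->|]; last by rewrite ltnS => le; rewrite IH //=; lia.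
rewrite (eq_bigr (fun=> 1)) => [|i _] /=; last by rewrite ltnS ltnW // ltn_ord.
by rewrite sum1_card card_ord ltnS leqnn addn1.
Qed.

Lemma trec_leq n F G : trec n F -> trec n G -> trec n (fun C v => F C v <= G C v : nat).
Proof.
move=> HF HG; apply: (@trec_ext _ (fun C v => 1 - (F C v - G C v))).
  by move=> C v _; lia.
by apply: trec_sub; [trec_leaf | apply: trec_sub].
Qed.

Lemma trec_div n F G : trec n F -> trec n G -> trec n (fun C v => F C v %/ G C v).
Proof.
move=> HF HG; apply: (@trec_comp2 n (fun _ v => nth 0 v 0 %/ nth 0 v 1)) => //.
(* The sum counts the positive multipliers that keep the product within the dividend; the last
   factor makes the quotient by 0 equal to 0. *)
apply: (@trec_ext _ (fun _ v => (\sum_(i < nth 0 v 0) (i.+1 * nth 0 v 1 <= nth 0 v 0)) *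
   (1 <= nth 0 v 1))).
  move=> _ v _; case: posnP => [->|q0] /=; first by rewrite muln0 divn0.
  rewrite muln1 -[RHS](@sum_ltn (nth 0 v 0)) ?leq_div //.
  by apply: eq_bigr => i _; rewrite leq_divRL.
apply: trec_mul; last by apply: trec_leq; trec_leaf.
apply: (@trec_sum _ _ (fun _ i v => (i.+1 * nth 0 v 1 <= nth 0 v 0) : nat)); first trec_leaf.
by apply: trec_leq; [apply: trec_mul; [apply: trec_succ|]|]; trec_leaf.
Qed.

Lemma trec_mod n F G : trec n F -> trec n G -> trec n (fun C v => F C v %% G C v).
Proof.
move=> HF HG; apply: (@trec_ext _ (fun C v => F C v - F C v %/ G C v * G C v)).
  by move=> C v _; rewrite {1}(divn_eq (F C v) (G C v)) addKn.
by apply: trec_sub => //; apply: trec_mul => //; apply: trec_div.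
Qed.

(** * Integer square root and pairing *)

Definition isqrt n := \sum_(i < n) (i.+1 * i.+1 <= n).

Lemma isqrt_eq n s : s * s <= n < s.+1 * s.+1 -> isqrt n = s.
Proof.
move=> /andP[le lt]; rewrite -[RHS](@sum_ltn n); last by case: s le {lt}; lia.
apply: eq_bigr => i _; congr nat_of_bool; apply/idP/idP; last by nia.
by rewrite ltnNge; apply: contraL; nia.
Qed.

Lemma trec_isqrt n F : trec n F -> trec n (fun C v => isqrt (F C v)).
Proof.
move=> HF; apply: (@trec_comp1 n (fun _ v => isqrt (nth 0 v 0))) => //.
apply: (@trec_sum _ _ (fun _ i v => (i.+1 * i.+1 <= nth 0 v 0) : nat)); first trec_leaf.
by apply: trec_leq; [apply: trec_mul; apply: trec_succ|]; trec_leaf.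
Qed.

(** The value lies between the squares of [a + b] and [a + b + 1], so its integer square root is
    [a + b] and the remainder is [a]. *)
Definition cpair a b := (a + b) * (a + b) + a.
Definition cfst n := n - isqrt n * isqrt n.
Definition csnd n := isqrt n - cfst n.

Lemma isqrt_cpair a b : isqrt (cpair a b) = a + b.
Proof. by apply: isqrt_eq; rewrite /cpair; nia. Qed.

Lemma cfst_cpair a b : cfst (cpair a b) = a.
Proof. by rewrite /cfst isqrt_cpair /cpair addKn. Qed.

Lemma csnd_cpair a b : csnd (cpair a b) = b.
Proof. by rewrite /csnd isqrt_cpair cfst_cpair addKn. Qed.

Lemma trec_cpair n F G : trec n F -> trec n G -> trec n (fun C v => cpair (F C v) (G C v)).
Proof. by move=> HF HG; apply: trec_add => //; apply: trec_mul; apply: trec_add. Qed.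

Lemma trec_cfst n F : trec n F -> trec n (fun C v => cfst (F C v)).
Proof. by move=> HF; apply: trec_sub => //; apply: trec_mul; apply: trec_isqrt. Qed.

Lemma trec_csnd n F : trec n F -> trec n (fun C v => csnd (F C v)).
Proof. by move=> HF; apply: trec_sub; [apply: trec_isqrt | apply: trec_cfst]. Qed.

Lemma trec_computable g : trec 1 (fun _ v => g (nth 0 v 0)) -> computable g.
Proof. by move=> [e He]; exists e => n; apply: (He _ [:: n]). Qed.

Lemma many_one_trans P Q R :
  many_one_reducible P Q -> many_one_reducible Q R -> many_one_reducible P R.
Proof.
move=> [g [[e He] PQ]] [h [[d Hd] QR]]; exists (h \o g); split.
  exists (RComp d (cons e nil)) => n; apply: (@ev_comp _ _ _ _ [:: g n]) => //.
  by apply: evs_cons; [apply: He | apply: evs_nil].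
by move=> w; rewrite PQ QR.
Qed.

(** * Compiling recursive functions to counter machines *)


(** The generated induction principle gives no hypothesis for the programs in the list of [RComp];
    the inner fixpoint supplies them. *)
Definition rfun_nested_ind (Pr : rfun -> Prop)
  (h0 : Pr RZero) (hS : Pr RSucc) (hP : forall i, Pr (RProj i)) (hO : Pr ROracle)
  (hC : forall g hs, Pr g -> List.Forall Pr hs -> Pr (RComp g hs))
  (hR : forall b s, Pr b -> Pr s -> Pr (RPrimRec b s))
  (hM : forall g, Pr g -> Pr (RMu g)) : forall e, Pr e :=
  fix F e := match e with
  | RZero => h0 | RSucc => hS | RProj i => hP i | ROracle => hO
  | RComp g hs => hC g hs (F g)
      ((fix Fs hs : List.Forall Pr hs := match hs with
        | nil => List.Forall_nil Pr
        | cons h hs' => List.Forall_cons h (F h) (Fs hs')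
        end) hs)
  | RPrimRec b s => hR b s (F b) (F s)
  | RMu g => hM g (F g)
  end.

Lemma reval_det C e v r r' : reval C e v r -> reval C e v r' -> r = r'.
Proof.
elim/rfun_nested_ind: e v r r' => [||i||g hs IHg IHhs|b s IHb IHs|g IHg] v r r' H H'.
- by inversion H; inversion H'.
- by inversion H; inversion H'.
- by inversion H; inversion H'.
- by inversion H; inversion H'.
- inversion H as [| | | |? ? ? ws ? Hws Hg| | | |]; subst.
  inversion H' as [| | | |? ? ? ws' ? Hws' Hg'| | | |]; subst.
  suff E : ws = ws' by move: Hg'; rewrite -E => /(IHg _ _ _ Hg).
  clear Hg Hg' H H'; elim: IHhs ws ws' Hws Hws' => [|h hs' IHh _ IH] ws ws' Hws Hws'.
    by inversion Hws; inversion Hws'.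
  inversion Hws; subst; inversion Hws'; subst; f_equal; first by apply: IHh; eassumption.
  by apply: IH.
- have rec n v1 : forall r r', reval C (RPrimRec b s) (n :: v1) r ->
    reval C (RPrimRec b s) (n :: v1) r' -> r = r'.
    elim: n => [|n IHn] r1 r2 H1 H2.
      inversion H1; subst; inversion H2; subst; by apply: IHb; eassumption.
    inversion H1 as [| | | | | |? ? ? ? a1 ? Ha1 Hs1| |]; subst.
    inversion H2 as [| | | | | |? ? ? ? a2 ? Ha2 Hs2| |]; subst.
    by rewrite (IHn _ _ Ha2 Ha1) in Hs2; apply: IHs Hs1 Hs2.
  case: v H H' => [|n v] H H'; last by apply: rec H H'.
  by inversion H; inversion H'; subst; apply: rec; eassumption.
- inversion H as [| | | | | | | |? ? ? H0 Hlt]; subst.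
  inversion H' as [| | | | | | | |? ? ? H0' Hlt']; subst.
  case: (ltngtP r r') => // lt.
    by have [x Hx nz] := Hlt' _ lt; case: nz; apply: IHg Hx H0.
  by have [x Hx nz] := Hlt _ lt; case: nz; apply: IHg Hx H0'.
Qed.

(** * Structured programs and counter machine code *)

Definition upd (s : nat -> nat) i x : nat -> nat := fun j => if j == i then x else s j.

Lemma upd_same s i x : upd s i x i = x.
Proof. by rewrite /upd eqxx. Qed.

Lemma upd_other s i x j : j <> i -> upd s i x j = s j.
Proof. by rewrite /upd; case: eqP. Qed.

Lemma upd_id s i : upd s i (s i) = s.
Proof. by apply: functional_extensionality => j; rewrite /upd; case: eqP => // ->. Qed.

(** [CCopy] assigns the successor, which is what one rightward sweep of a head can do on unary
    tracks. It serves as increment for [i = j], and as assignment when [CDec] follows. *)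
Inductive cmd :=
| CSkip
| CCopy (i j : nat)
| CDec (i : nat)
| CQuery (i j : nat)
| CSeq (c1 c2 : cmd)
| CLoop (i : nat) (c : cmd).

Inductive exec (C : nat -> bool) : cmd -> (nat -> nat) -> (nat -> nat) -> Prop :=
| ex_skip s : exec C CSkip s s
| ex_copy i j s : exec C (CCopy i j) s (upd s j (s i).+1)
| ex_dec i s : exec C (CDec i) s (upd s i (s i).-1)
| ex_query i j s : exec C (CQuery i j) s (upd s j (C (s i) + s j))
| ex_seq c1 c2 s s1 s2 : exec C c1 s s1 -> exec C c2 s1 s2 -> exec C (CSeq c1 c2) s s2
| ex_loop0 i c s : s i = 0 -> exec C (CLoop i c) s s
| ex_loopS i c s s1 s2 : s i <> 0 -> exec C c (upd s i (s i).-1) s1 ->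
    exec C (CLoop i c) s1 s2 -> exec C (CLoop i c) s s2.

Inductive instr :=
| IQuery (i n0 n1 : nat)
| ICopy (i j n : nat)
| IDec (i nz np : nat).

Fixpoint csize c := match c with
| CQuery _ _ => 2
| CSeq c1 c2 => csize c1 + csize c2
| CLoop _ c => (csize c).+1
| _ => 1
end.

(** [o] is the address where the code is placed and [nxt] the address where control goes afterwards.
    A query with equal targets is a jump. *)
Fixpoint code c o nxt : seq instr := match c with
| CSkip => [:: IQuery 0 nxt nxt]
| CCopy i j => [:: ICopy i j nxt]
| CDec i => [:: IDec i nxt nxt]
| CQuery i j => [:: IQuery i nxt o.+1; ICopy j j nxt]
| CSeq c1 c2 => code c1 o (o + csize c1) ++ code c2 (o + csize c1) nxt
| CLoop i c => IDec i nxt o.+1 :: code c o.+1 o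
end.

Lemma size_code c o nxt : size (code c o nxt) = csize c.
Proof.
by elim: c o nxt => //= [c1 IH1 c2 IH2|i c IH] o nxt; rewrite ?size_cat ?IH1 ?IH2 ?IH.
Qed.

Definition mstep (P : seq instr) C (x : nat * (nat -> nat)) : nat * (nat -> nat) :=
  let: (pc, s) := x in
  match nth (IQuery 0 0 0) P pc with
  | IQuery i n0 n1 => (if C (s i) then n1 else n0, s)
  | ICopy i j n => (n, upd s j (s i).+1)
  | IDec i nz np => if s i is k.+1 then (np, upd s i k) else (nz, s)
  end.

(** Only the last configuration of a run may be at address 0. As this is the address shown in the
    window, the window cannot occur in between. *)
Inductive mrun P C : nat * (nat -> nat) -> nat * (nat -> nat) -> Prop :=
| mrun1 x : 0 < x.1 < size P -> mrun P C x (mstep P C x)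
| mrunS x z : 0 < x.1 < size P -> mrun P C (mstep P C x) z -> mrun P C x z.

Lemma mrun_trans P C x y z : mrun P C x y -> mrun P C y z -> mrun P C x z.
Proof.
move=> H; elim: H z => [{}x lt|{}x {}y lt _ IH] z Hz; first exact: mrunS.
by apply: mrunS => //; apply: IH.
Qed.

Definition placed (P : seq instr) o l := exists pre post, P = pre ++ l ++ post /\ size pre = o.

Lemma placed_cat P o l1 l2 : placed P o (l1 ++ l2) ->
  placed P o l1 /\ placed P (o + size l1) l2.
Proof.
move=> [pre [post [-> <-]]]; split.
  by exists pre, (l2 ++ post); rewrite !catA.
by exists (pre ++ l1), post; rewrite !catA size_cat.
Qed.

Lemma placed_hd P o i l d : placed P o (i :: l) -> nth d P o = i /\ o < size P.
Proof.
move=> [pre [post [-> <-]]]; rewrite nth_cat ltnn subnn; split=> //.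
by rewrite size_cat /= -[X in X < _]addn0 ltn_add2l.
Qed.

Lemma exec_mrun P C c s s' : exec C c s s' -> forall o nxt, 0 < o ->
  placed P o (code c o nxt) -> mrun P C (o, s) (nxt, s').
Proof.
elim=> {c s s'} [s|i j s|i s|i j s|c1 c2 s s1 s2 _ IH1 _ IH2|i c s si|i c s s1 s2 si _ IH1 _ IH2]
  o nxt o0 Hp.
- have [E lt] := placed_hd (IQuery 0 0 0) Hp.
  have := @mrun1 P C (o, s); rewrite /= E o0 lt if_same; exact.
- have [E lt] := placed_hd (IQuery 0 0 0) Hp.
  have := @mrun1 P C (o, s); rewrite /= E o0 lt; exact.
- have [E lt] := placed_hd (IQuery 0 0 0) Hp.
  have := @mrun1 P C (o, s); rewrite /= E o0 lt.
  case E2: (s i) => [|k] /=; last exact.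
  have -> : upd s i 0 = s by rewrite -E2 upd_id.
  exact.
- have [E lt] := placed_hd (IQuery 0 0 0) Hp.
  have [_] := @placed_cat _ _ [:: _] _ Hp; rewrite addn1 => Hp2.
  have [E2 lt2] := placed_hd (IQuery 0 0 0) Hp2.
  case Cs: (C (s i)); last first.
    rewrite upd_id; have := @mrun1 P C (o, s); rewrite /= E o0 lt Cs; exact.
  apply: mrunS; rewrite /= ?o0 ?lt // E Cs.
  have := @mrun1 P C (o.+1, s); rewrite /= E2 lt2; exact.
- have [H1 H2] := placed_cat Hp; rewrite size_code in H2.
  apply: (mrun_trans (IH1 _ _ o0 H1)); apply: IH2 H2; lia.
- have [E lt] := placed_hd (IQuery 0 0 0) Hp.
  have := @mrun1 P C (o, s); rewrite /= E o0 lt si; exact.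
- have [E lt] := placed_hd (IQuery 0 0 0) Hp.
  have [_] := @placed_cat _ _ [:: _] _ Hp; rewrite addn1 => Hp2.
  apply: mrunS; rewrite /= ?o0 ?lt // E.
  case Es: (s i) si IH1 => [|k] //= _ IH1.
  by apply: (mrun_trans (IH1 _ _ _ Hp2)) => //; apply: IH2.
Qed.

(* Register 0 holds the input and register 1 the constant 0. Oracle queries are shifted by the
   input plus 1, because the bits of the oracle track inside the window are prescribed. *)
Definition rzr := 1.

Definition CMove i j := CSeq (CCopy i j) (CDec j).
Definition CZero i := CLoop i (CDec i).

(** Registers from [fr] on are scratch, and missing arguments are read from [rzr]. For [RPrimRec],
    [fr] counts the remaining rounds, [fr.+1] the completed ones, and [fr.+2] is the accumulator;
    for [RMu], [fr] is the candidate and [fr.+1] the value of [g] there. *)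
Fixpoint rcompile (e : rfun) (args : seq nat) (out fr : nat) {struct e} : cmd :=
  match e with
  | RZero => CMove rzr out
  | RSucc => CCopy (nth rzr args 0) out
  | RProj i => CMove (nth rzr args i) out
  | ROracle =>
      CSeq (CCopy 0 fr) (CSeq (CMove (nth rzr args 0) fr.+1)
        (CSeq (CLoop fr.+1 (CCopy fr fr)) (CSeq (CMove rzr out) (CQuery fr out))))
  | RComp g hs =>
      let fr' := fr + size hs in
      CSeq ((fix comps hs k := match hs with
             | nil => CSkip
             | cons h hs' => CSeq (rcompile h args k fr') (comps hs' k.+1)
             end) hs fr)
        (rcompile g (iota fr (size hs)) out fr')
  | RPrimRec b s =>
      CSeq (CMove (nth rzr args 0) fr) (CSeq (CMove rzr fr.+1)
        (CSeq (rcompile b (behead args) fr.+2 fr.+4)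
          (CSeq (CLoop fr
                  (CSeq (rcompile s [:: fr.+1, fr.+2 & behead args] fr.+3 fr.+4)
                    (CSeq (CMove fr.+3 fr.+2) (CCopy fr.+1 fr.+1))))
            (CMove fr.+2 out))))
  | RMu g =>
      CSeq (CMove rzr fr) (CSeq (rcompile g (fr :: args) fr.+1 fr.+2)
        (CSeq (CLoop fr.+1 (CSeq (CCopy fr fr) (rcompile g (fr :: args) fr.+1 fr.+2)))
          (CMove fr out)))
  end.

Lemma exec_move C i j s : i != j -> exec C (CMove i j) s (upd s j (s i)).
Proof.
move=> ne; apply: (ex_seq (ex_copy C i j s)).
have -> : upd s j (s i) =
    upd (upd s j (s i).+1) j (upd s j (s i).+1 j).-1; last exact: ex_dec.
by apply: functional_extensionality => k; rewrite /upd eqxx /=; case: (k == j).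
Qed.

Lemma exec_zero C i s : exec C (CZero i) s (upd s i 0).
Proof.
have [n] := ubnP (s i); elim: n s => // n IH s lt.
case E: (s i) => [|k].
  by rewrite -E upd_id; apply: ex_loop0.
apply: (ex_loopS _ (ex_dec _ _ _)); first by rewrite E.
rewrite upd_same E /=.
have -> : upd s i 0 = upd (upd (upd s i k) i k.-1) i 0.
  by apply: functional_extensionality => j; rewrite /upd; case: (j == i).
by apply: IH; rewrite upd_same; lia.
Qed.

(** Derivations unfold the recursion from [n] down, whereas the compiled loop runs from 0 up; the
    sequence [a] of all intermediate values links the two. *)
Lemma reval_primrec_seq C b s n v r : reval C (RPrimRec b s) (n :: v) r ->
  exists a : nat -> nat, [/\ reval C b v (a 0), a n = r &
    forall j, j < n -> reval C s [:: j, a j & v] (a j.+1)].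
Proof.
elim: n r => [|n IH] r H.
  by inversion H; subst; exists (fun=> r).
inversion H as [| | | | | |? ? ? ? a1 ? Ha1 Hs1| |]; subst.
have [a [H0 Hn Hj]] := IH _ Ha1.
exists (fun j => if j <= n then a j else r); split=> //=; first by rewrite ltnn.
move=> j; rewrite ltnS leq_eqVlt => /predU1P[->|lt] /=.
  by rewrite eqxx ltnn Hn.
by rewrite lt orbT; apply: Hj.
Qed.

Section CompileCorrect.
Variables (C C0 : nat -> bool) (w : nat).
Hypothesis HC : forall n, C n = C0 (n + w.+1).

(** The oracle track is [C0], and the program sees its shift [C]. The bound [1 < out] protects the
    input and the constant 0. The clause on [nth] ranges over all [i], as missing arguments are 0 on
    both sides. *)
Definition rcompile_ok e := forall s args v out fr r,
  s 0 == w -> s rzr = 0 -> 1 < out < fr -> all (fun a => a < fr) args ->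
  (forall i, nth 0 v i = s (nth rzr args i)) -> reval C e v r ->
  exists s', [/\ exec C0 (rcompile e args out fr) s s', s' out = r &
    forall j, j < fr -> j <> out -> s' j = s j].

Lemma nth_args (args : seq nat) fr i : 1 < fr -> all (fun a => a < fr) args ->
  nth rzr args i < fr.
Proof.
move=> fr1 /allP H; case: (ltnP i (size args)) => lt; last by rewrite nth_default.
exact/H/mem_nth.
Qed.

Lemma rcompile_correct e : rcompile_ok e.
Proof.
elim/rfun_nested_ind: e => [||k||g hs IHg IHhs|b sf IHb IHs|g IHg]
  s args v out fr r s0 s1 Hout Hargs Hv H.
- inversion H; subst; exists (upd s out (s rzr)); split.
  + by apply: exec_move; rewrite /rzr; lia.
  + by rewrite upd_same s1.
  + by move=> j _ ne; rewrite upd_other.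
- inversion H; subst; exists (upd s out (s (nth rzr args 0)).+1); split.
  + exact: ex_copy.
  + by rewrite upd_same -Hv nth0.
  + by move=> j _ ne; rewrite upd_other.
- inversion H; subst; case: (eqVneq (nth rzr args k) out) => [E|ne].
    exists (upd s out (s out)); split.
    + apply: (ex_seq (ex_copy _ _ _ _)); rewrite E.
      have -> : upd s out (s out) = upd (upd s out (s out).+1) out (upd s out (s out).+1 out).-1.
        by apply: functional_extensionality => j; rewrite /upd eqxx /=; case: (j == out).
      exact: ex_dec.
    + by rewrite upd_same Hv E.
    + by move=> j _ ne; rewrite upd_other.
  exists (upd s out (s (nth rzr args k))); split; first exact: exec_move.
  + by rewrite upd_same Hv.
  + by move=> j _ ne'; rewrite upd_other.
- inversion H; subst.
  have lt0 := @nth_args args fr 0 ltac:(lia) Hargs.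
  set a := nth rzr args 0 in lt0.
  pose s2 := upd (upd s fr w.+1) fr.+1 (s a).
  have loop n : forall t, exists t', [/\ t fr.+1 = n -> exec C0 (CLoop fr.+1 (CCopy fr fr)) t t',
      t' fr = t fr + n & forall j, j < fr -> t' j = t j].
    elim: n => [|n IHn] t; first by exists t; split; [apply: ex_loop0 | rewrite addn0 |].
    have [t' [E1 E2 E3]] := IHn (upd (upd t fr.+1 n) fr (t fr).+1).
    exists t'; split.
    + move=> tn; apply: (ex_loopS (s1 := upd (upd t fr.+1 n) fr (t fr).+1)).
      * by rewrite tn.
      * have := ex_copy C0 fr fr (upd t fr.+1 n); rewrite upd_other; last lia.
        by rewrite tn.
      * by apply: E1; rewrite upd_other ?upd_same //; lia.
    + by rewrite E2 upd_same; lia.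
    + by move=> j lt; rewrite E3 // !upd_other //; lia.
  have [s3 [E1 E2 E3]] := loop (s a) s2.
  exists (upd (upd s3 out 0) out (C0 (s3 fr) + 0)); split.
  + apply: (ex_seq (ex_copy _ _ _ _)); rewrite (eqP s0).
    apply: (ex_seq (s1 := s2)).
      have -> : s2 = upd (upd s fr w.+1) fr.+1 (upd s fr w.+1 a).
        by rewrite /s2 [in RHS]upd_other //; lia.
      by apply: exec_move; lia.
    apply: (ex_seq (E1 _)); first by rewrite /s2 upd_same.
    have Ez : s3 rzr = 0 by rewrite E3 ?/s2 ?upd_other // /rzr; lia.
    apply: (ex_seq (s1 := upd s3 out 0)).
      by rewrite -Ez; apply: exec_move; rewrite /rzr; lia.
    have := ex_query C0 fr out (upd s3 out 0).
    by rewrite upd_same upd_other //; lia.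
  + rewrite upd_same addn0 E2 /s2 upd_other ?upd_same; last lia.
    rewrite -nth0 Hv -/a HC addnC; by case: (C0 _).
  + by move=> j lt ne; rewrite !upd_other // E3 // /s2 !upd_other //; lia.
- inversion H as [| | | |? ? ? ws ? Hws Hg| | | |]; subst => {H}.
  (* Invariant of the inner fixpoint: the results occupy consecutive registers from [k] on, and all
     argument programs share the scratch area from [fr']. *)
  have : forall fr' k s, fr <= k -> 1 < k -> k + size hs = fr' -> s 0 == w -> s rzr = 0 ->
     (forall i, nth 0 v i = s (nth rzr args i)) ->
     exists s', [/\ exec C0 ((fix comps hs k := match hs with
             | nil => CSkip
             | cons h hs' => CSeq (rcompile h args k fr') (comps hs' k.+1)
             end) hs k) s s', forall i, i < size hs -> s' (k + i) = nth 0 ws i,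
       forall j, j < k -> s' j = s j & size ws = size hs].
    clear Hg s s0 s1 Hv; elim: IHhs ws Hws => [|h hs' IHh _ IH] ws Hws fr' k s lek k1 Ek s0 s1 Hv.
      by inversion Hws; subst; exists s; split=> //; apply: ex_skip.
    inversion Hws as [|? ? ? w1 ws' Hw1 Hws']; subst => {Hws} /=.
    set fr' := k + (size hs').+1.
    have Hargs' : all (fun a => a < fr') args.
      by apply: sub_all Hargs => a; rewrite /fr'; lia.
    have [t [Et1 Et2 Et3]] := IHh s args v k fr' w1 s0 s1 ltac:(rewrite /fr'; lia) Hargs' Hv Hw1.
    have Pt j : j < k -> t j = s j by move=> lt; apply: Et3; rewrite /fr'; lia.
    have [||||||u [Eu1 Eu2 Eu3 Eu4]] := IH _ Hws' fr' k.+1 t; try by rewrite /fr'; lia.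
    + by rewrite Pt //; lia.
    + by rewrite Pt.
    + move=> i; rewrite Hv Pt //.
      by have := @nth_args args fr i ltac:(lia) Hargs; lia.
    exists u; split.
    + exact: ex_seq Et1 Eu1.
    + move=> [|i] lt; first by rewrite addn0 Eu3 //= Et2.
      by rewrite addnS -addSn Eu2.
    + by move=> j lt; rewrite Eu3 ?Pt //; lia.
    + by rewrite /= Eu4.
  move=> /(_ (fr + size hs) fr s) [] //; first lia.
  move=> t [Et1 Et2 Et3 Et4].
  have [||||i|u [Eu1 Eu2 Eu3]] := IHg t (iota fr (size hs)) ws out (fr + size hs) r _ _ _ _ _ Hg.
  + by rewrite Et3 //; lia.
  + by rewrite Et3 // /rzr; lia.
  + lia.
  + by apply/allP => a; rewrite mem_iota; lia.
  + case: (ltnP i (size hs)) => lt; first by rewrite nth_iota // Et2.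
    by rewrite !nth_default ?size_iota ?Et4 // Et3 // /rzr; lia.
  exists u; split=> //; first exact: ex_seq Et1 Eu1.
  by move=> j lt ne; rewrite Eu3 ?Et3 //; lia.
- have {H} : reval C (RPrimRec b sf) (nth 0 v 0 :: behead v) r.
    by case: v H {Hv} => // H; inversion H.
  move=> /reval_primrec_seq [a [Ha0 Han Haj]].
  have lt0 i := @nth_args args fr i ltac:(lia) Hargs.
  set n := nth 0 v 0 in Han Haj.
  pose st1 := upd (upd s fr n) fr.+1 0.
  have P1 j : j < fr -> st1 j = s j by move=> lt; rewrite /st1 !upd_other //; lia.
  have Hargs' : all (fun a => a < fr.+4) (behead args).
    by apply/allP => x /mem_behead /(allP Hargs); lia.
  have Hv' t : (forall j, j < fr -> t j = s j) -> forall i, nth 0 (behead v) i = t (nth rzr (behead args) i).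
    by move=> Ht i; rewrite !nth_behead Hv Ht.
  have [|||st2 [E1 E2 E3]] := IHb st1 (behead args) (behead v) fr.+2 fr.+4 (a 0) _ _ _ Hargs' (Hv' _ P1) Ha0.
  + by rewrite P1 //; lia.
  + by rewrite P1 // /rzr; lia.
  + lia.
  rewrite /=; set body := CSeq _ (CSeq (CMove fr.+3 fr.+2) _).
  have loop k : forall t j, t fr = k -> t fr.+1 = j -> j + k = n -> t fr.+2 = a j ->
     (forall j, j < fr -> t j = s j) ->
     exists t', [/\ exec C0 (CLoop fr body) t t', t' fr.+2 = r & forall j, j < fr -> t' j = s j].
    elim: k => [|k IHk] t j t1 t2 jk t3 t4.
      by exists t; split=> //; [apply: ex_loop0 | rewrite t3 -Han -jk addn0].
    have T4 x : x < fr -> upd t fr k x = s x by move=> lt; rewrite upd_other ?t4 //; lia.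
    have [||||i||u [U1 U2 U3]] := IHs (upd t fr k) [:: fr.+1, fr.+2 & behead args]
        [:: j, a j & behead v] fr.+3 fr.+4 (a j.+1).
    + by rewrite T4 //; lia.
    + by rewrite T4 // /rzr; lia.
    + lia.
    + by rewrite /= Hargs'; lia.
    + case: i => [|[|i]] /=; try by rewrite upd_other //; lia.
      exact: Hv'.
    + by apply: Haj; lia.
    have [|||||t' [T1 T2 T3]] := IHk (upd (upd u fr.+2 (a j.+1)) fr.+1 j.+1) j.+1.
    + by rewrite !upd_other; [rewrite U3 ?upd_same|..]; lia.
    + by rewrite upd_same.
    + lia.
    + by rewrite upd_other ?upd_same //; lia.
    + by move=> x lt; rewrite !upd_other ?U3 ?T4 //; lia.
    exists t'; split=> //.
    apply: (ex_loopS _ _ T1); first by rewrite t1.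
    rewrite t1 /=; apply: (ex_seq U1).
    apply: (ex_seq (s1 := upd u fr.+2 (a j.+1))).
      by rewrite -U2; apply: exec_move; lia.
    have := ex_copy C0 fr.+1 fr.+1 (upd u fr.+2 (a j.+1)).
    have E : u fr.+1 = j by rewrite U3 ?upd_other //; lia.
    by rewrite upd_other ?E //; lia.
  have [||||x|t' [T1 T2 T3]] := loop n st2 0.
  + by rewrite E3 /st1; [rewrite upd_other ?upd_same //; lia|lia|lia].
  + by rewrite E3 /st1; [rewrite upd_same|lia|lia].
  + by [].
  + by [].
  + by move=> lt; rewrite E3 ?P1 //; lia.
  exists (upd t' out r); split.
  + apply: (ex_seq (s1 := upd s fr n)).
      by rewrite /n Hv; apply: exec_move; have := lt0 0; lia.
    apply: (ex_seq (s1 := st1)).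
      have := @exec_move C0 rzr fr.+1 (upd s fr n).
      by rewrite upd_other ?s1; [apply | rewrite /rzr; lia]; rewrite /rzr; lia.
    apply: (ex_seq E1); apply: (ex_seq T1); rewrite -T2; apply: exec_move; lia.
  + by rewrite upd_same.
  + by move=> j lt ne; rewrite upd_other // T3.
- inversion H as [| | | | | | | |? ? ? H0 Hlt]; subst.
  have lt0 i := @nth_args args fr i ltac:(lia) Hargs.
  have Hargs' : all (fun a => a < fr.+2) (fr :: args).
    by rewrite /=; apply/andP; split; [lia | apply: sub_all Hargs => x; lia].
  have run m t x : reval C g (m :: v) x -> t fr = m -> (forall j, j < fr -> t j = s j) ->
     exists t', [/\ exec C0 (rcompile g (fr :: args) fr.+1 fr.+2) t t', t' fr.+1 = x, t' fr = m &
        forall j, j < fr -> t' j = s j].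
    move=> Hx tm Ht.
    have [||||[|i]|u [U1 U2 U3]] := IHg t (fr :: args) (m :: v) fr.+1 fr.+2 x _ _ _ _ _ Hx => //=.
    + by rewrite Ht //; lia.
    + by rewrite Ht // /rzr; lia.
    + lia.
    + by rewrite Hv Ht.
    exists u; split=> //; first by rewrite U3.
    by move=> j lt; rewrite U3 ?Ht //; lia.
  rewrite /=; set body := CSeq (CCopy fr fr) _.
  have loop k : forall t m, m + k = r -> t fr = m -> reval C g (m :: v) (t fr.+1) ->
     (forall j, j < fr -> t j = s j) ->
     exists t', [/\ exec C0 (CLoop fr.+1 body) t t', t' fr = r & forall j, j < fr -> t' j = s j].
    elim: k => [|k IHk] t m mk tm Hm Ht.
      have Em : m = r by lia.
      rewrite Em in tm Hm; exists t; split=> //; apply: ex_loop0.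
      exact: (reval_det Hm H0).
    have [x Hx nz] := Hlt m ltac:(lia).
    have Ex : t fr.+1 = x by apply: reval_det Hm Hx.
    (* The body evaluates [g] at [m + 1] before the loop test; for [m + 1 = r] the value is the
       final 0. *)
    have [y Hy] : exists y, reval C g (m.+1 :: v) y.
      case: (ltngtP m.+1 r) => lt; first by have [y] := Hlt _ lt; exists y.
        lia.
      by exists 0; rewrite lt.
    have [||u [U1 U2 U3 U4]] := run m.+1 (upd (upd t fr.+1 x.-1) fr m.+1) y Hy.
    + by rewrite upd_same.
    + by move=> j lt; rewrite !upd_other ?Ht //; lia.
    have [||||t' [T1 T2 T3]] := IHk u m.+1 => //; first lia.
      by rewrite U2.
    exists t'; split=> //; apply: (ex_loopS _ _ T1); first by rewrite Ex.
    rewrite Ex; apply: (ex_seq _ U1).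
    have := ex_copy C0 fr fr (upd t fr.+1 x.-1).
    by rewrite upd_other ?tm //; lia.
  have [x0 Hx0] : exists y, reval C g (0 :: v) y.
    by case: (posnP r) => [E|/Hlt [y]]; [exists 0; rewrite -{1}E | exists y].
  have [||u [U1 U2 U3 U4]] := run 0 (upd s fr 0) x0 Hx0.
  + by rewrite upd_same.
  + by move=> j lt; rewrite upd_other //; lia.
  have [||||t' [T1 T2 T3]] := loop r u 0 => //; first by rewrite U2.
  exists (upd t' out r); split.
  + apply: (ex_seq (s1 := upd s fr 0)).
      by rewrite -s1; apply: exec_move; rewrite /rzr; lia.
    apply: (ex_seq U1); apply: (ex_seq T1); rewrite -T2; apply: exec_move; lia.
  + by rewrite upd_same.
  + by move=> j lt ne; rewrite upd_other // T3.
Qed.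

End CompileCorrect.

(** * The main loop *)


Fixpoint cok K c := match c with
| CSkip => true
| CCopy i j | CQuery i j => (i <= K) && (j <= K)
| CDec i => i <= K
| CSeq c1 c2 => cok K c1 && cok K c2
| CLoop i c => (i <= K) && cok K c
end.

Definition iok K x := match x with
| IQuery i _ _ | IDec i _ _ => i <= K
| ICopy i j _ => (i <= K) && (j <= K)
end.

Lemma cokW K K' c : K <= K' -> cok K c -> cok K' c.
Proof.
move=> le; elim: c => //= [i j|i|i j|c1 IH1 c2 IH2 /andP[/IH1 -> /IH2 ->]|i c IH /andP[lt /IH ->]] //.
- by move=> /andP[]; lia.
- by lia.
- by move=> /andP[]; lia.
- by rewrite andbT; lia.
Qed.

Lemma cok_exists c : exists K, cok K c.
Proof.
elim: c => [|i j|i|i j|c1 [K1 H1] c2 [K2 H2]|i c [K H]]; first by exists 0.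
- by exists (i + j) => /=; lia.
- by exists i => /=.
- by exists (i + j) => /=; lia.
- exists (K1 + K2) => /=; rewrite (cokW _ H1) ?(cokW _ H2) //; lia.
- exists (i + K) => /=; rewrite (cokW _ H); lia.
Qed.

Lemma code_iok K c o nxt : cok K c -> all (iok K) (code c o nxt).
Proof.
elim: c o nxt => //= [i j|i|i j|c1 IH1 c2 IH2|i c IH] o nxt; rewrite ?andbT //.
- by move=> /andP[-> ->].
- by rewrite all_cat => /andP[/IH1 -> /IH2 ->].
- by move=> /andP[-> /IH ->].
Qed.

(** Register 0 plus 1 will be the number of window cells, so the filled registers have tracks
    constantly 1 on the window. *)
Definition CFill l := foldr (fun t c => CSeq (CCopy 0 t) c) CSkip l.

(* Registers: 2 is the universally quantified variable m, 3 the bound l on its witness,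
   4 the success flag, 5 the value of the checked predicate. The step is first recorded as
   a success and this is undone, by a loop run at most once, when register 5 is nonzero. *)
Definition CUpdate := CSeq (CCopy 0 4) (CSeq (CCopy 2 2)
  (CLoop 5 (CSeq (CZero 5) (CSeq (CDec 2) (CSeq (CZero 4) (CCopy 3 3)))))).

Definition CCheck e := rcompile e [:: 2; 3; 0] 5 6.

Definition CBody e K :=
  CSeq (CZero rzr) (CSeq (CCheck e) (CSeq CUpdate (CFill (1 :: iota 5 (K - 4))))).

(** The program opens with one probe per register, a query with equal targets. Probes change
    nothing, but a head on a track without a 0 never returns; so recurrence of the window guarantees
    that every track encodes a number. *)
Definition prog e K := mkseq (fun i => IQuery i i.+1 i.+1) K.+1 ++ code (CBody e K) K.+1 0.

Lemma cok_body e K : 5 <= K -> cok K (CCheck e) -> cok K (CBody e K).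
Proof.
move=> K5 He; rewrite /CBody /= He /=.
have F l : all (fun t => t <= K) l -> cok K (CFill l) by elim: l => //= t l IH /andP[-> /IH ->].
rewrite F; first by rewrite /rzr; lia.
by apply/allP => t; rewrite mem_iota; lia.
Qed.

Lemma prog_iok e K i : 5 <= K -> cok K (CCheck e) ->
  iok K (nth (IQuery 0 0 0) (prog e K) i).
Proof.
move=> K5 He; have H : all (iok K) (prog e K).
  rewrite all_cat code_iok ?cok_body // andbT.
  by rewrite all_map; apply/allP => j; rewrite mem_iota /=; lia.
by case: (ltnP i (size (prog e K))) => lt; [move/all_nthP: H; apply | rewrite nth_default].
Qed.

Lemma exec_fill C l s : 0 \notin l ->
  exec C (CFill l) s (fun t => if t \in l then (s 0).+1 else s t).
Proof.
elim: l s => [|t l IH] s; first by move=> _; apply: ex_skip.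
rewrite inE negb_or => /andP[t0 l0]; apply: (ex_seq (ex_copy _ _ _ _)).
have := IH (upd s t (s 0).+1) l0.
rewrite (_ : (fun _ => _) = (fun k => if k \in t :: l then (s 0).+1 else s k)) //.
apply: functional_extensionality => k; rewrite inE /upd (negPf t0).
by case: (k == t); rewrite //= if_same.
Qed.

(** Register 4 makes the outcome visible: after a failure it is 0, so its track shows a 0 at the
    wall. Registers 2 and 3 are not refilled, since they carry the search from one pass to the
    next. *)
Lemma exec_body C C0 w K e s g : 5 <= K -> (forall n, C n = C0 (n + w.+1)) -> s 0 = w ->
  reval C e [:: s 2; s 3; w] g ->
  exists s', [/\ exec C0 (CBody e K) s s', s' 0 = w,
    (g = 0 -> [/\ s' 2 = (s 2).+1, s' 3 = s 3 & s' 4 = w.+1]),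
    (g <> 0 -> [/\ s' 2 = s 2, s' 3 = (s 3).+1 & s' 4 = 0]) &
    forall t, t <= K -> t = 1 \/ 5 <= t -> s' t = w.+1].
Proof.
move=> K5 HC s0 Hg.
pose s1 := upd s rzr 0.
have [||||i||s2 [E1 E2 E3]] := @rcompile_correct C C0 w HC e s1 [:: 2; 3; 0] [:: s 2; s 3; w] 5 6 g => //.
- by rewrite /s1 upd_other // s0.
- by case: i => [|[|[|i]]] //=; rewrite !nth_nil /s1 upd_same.
have {}E3 j : j < 5 -> j <> 1 -> s2 j = s j.
  by move=> lt ne; rewrite E3 ?/s1 ?upd_other //; lia.
pose s3 := upd (upd s2 4 w.+1) 2 (s 2).+1.
have [s4 [F0 F1 F2 F3]] : exists s4, [/\ exec C0 CUpdate s2 s4, s4 0 = w,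
    (g = 0 -> [/\ s4 2 = (s 2).+1, s4 3 = s 3 & s4 4 = w.+1]) &
    (g <> 0 -> [/\ s4 2 = s 2, s4 3 = (s 3).+1 & s4 4 = 0])].
  have X1 : exec C0 (CCopy 0 4) s2 (upd s2 4 w.+1).
    by have := ex_copy C0 0 4 s2; rewrite E3 // s0.
  have X2 : exec C0 (CCopy 2 2) (upd s2 4 w.+1) s3.
    by have := ex_copy C0 2 2 (upd s2 4 w.+1); rewrite upd_other // E3.
  have s35 : s3 5 = g by rewrite /s3 !upd_other.
  case: (eqVneq g 0) => [g0|/eqP g0].
    exists s3; split.
    - by apply: (ex_seq X1); apply: (ex_seq X2); apply: ex_loop0; rewrite s35.
    - by rewrite /s3 !upd_other // E3.
    - by move=> _; rewrite /s3 upd_same; split=> //; rewrite !upd_other // ?upd_same // E3.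
    - by [].
  pose s5 := upd s3 5 g.-1; pose s6 := upd s5 5 0; pose s7 := upd s6 2 (s6 2).-1.
  pose s8 := upd s7 4 0; pose s9 := upd s8 3 (s8 3).+1.
  have E0 : s9 0 = w by rewrite /s9 /s8 /s7 /s6 /s5 /s3 !upd_other // E3.
  exists s9; split=> //.
    apply: (ex_seq X1); apply: (ex_seq X2).
    apply: (ex_loopS (s1 := s9)); first by rewrite s35.
      rewrite s35; apply: (ex_seq (exec_zero _ _ _)); apply: (ex_seq (ex_dec _ _ _)).
      by apply: (ex_seq (exec_zero _ _ _)); apply: ex_copy.
    by apply: ex_loop0; rewrite /s9 upd_other // /s8 upd_other // /s7 upd_other // /s6 upd_same.
  move=> _; split.
  - by [].
  - by rewrite /s9 upd_same /s8 /s7 /s6 /s5 /s3 !upd_other // E3.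
  - by rewrite /s9 upd_other // /s8 upd_same.
pose l := 1 :: iota 5 (K - 4).
exists (fun t => if t \in l then (s4 0).+1 else s4 t); split.
- apply: (ex_seq (exec_zero _ _ _)); apply: (ex_seq E1); apply: (ex_seq F0).
  by apply: exec_fill; rewrite /l inE mem_iota.
- by rewrite /l inE mem_iota /= F1.
- by rewrite /l !inE !mem_iota.
- by rewrite /l !inE !mem_iota.
- move=> t tK Ht; rewrite F1 /l inE mem_iota.
  by have -> : (t == 1) || (4 < t < 5 + (K - 4)) by lia.
Qed.

(** * A one-head machine running counter programs *)


Inductive move := ML | MS | MR.

Section Machine.
Variables (P : seq instr) (K : nat).

(* The second component is the phase of the current instruction: None while walking right
   to the first 0 of a track, Some None when rewriting the cell reached, Some (Some b)
   while walking back home with the answer b. *)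
Definition state : Type := ('I_(size P).+1 * option (option bool))%type.
Definition data : Type := (bool * {ffun 'I_K.+1 -> bool})%type.

Definition track (a : data) i := a.2 (inord i).
Definition set_track (a : data) i b : data :=
  (a.1, [ffun k => if k == inord i then b else a.2 k]).

Lemma track_set a i b : track (set_track a i b) i = b.
Proof. by rewrite /track ffunE eqxx. Qed.

Lemma track_set_other a i j b : i <= K -> j <= K -> j <> i ->
  track (set_track a i b) j = track a j.
Proof.
move=> iK jK ne; rewrite /track ffunE; case: eqP => // /(congr1 val) /=.
by rewrite !inordK.
Qed.

Definition fetch (pc : nat) := nth (IQuery 0 0 0) P pc.

Definition next_pc pc b := match fetch pc with
| ICopy _ _ n => n
| IDec _ _ np => np
| IQuery _ n0 n1 => if b then n1 else n0
end.

(** The oracle bit at the first 0 of the track answers a query. A copy writes 1s on track [j] up to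
    and including that cell and a 0 in the next one. A decrement steps back one cell and writes a 0
    there; a first 0 at the wall means value 0. *)
Definition delta (q : state) (wall : bool) (a : data) : state * data * move :=
  let: (pc, ph) := q in
  match ph with
  | None => match fetch pc with
    | ICopy i j _ => ((pc, if track a i then None else Some None), set_track a j true, MR)
    | IDec i nz _ => if track a i then (q, a, MR)
        else if wall then ((inord nz, None), a, MS) else ((pc, Some None), a, ML)
    | IQuery i _ _ => if track a i then (q, a, MR) else ((pc, Some (Some a.1)), a, MS)
    end
  | Some None => match fetch pc with
    | ICopy _ j _ => ((pc, Some (Some false)), set_track a j false, MS)
    | IDec i _ _ => ((pc, Some (Some false)), set_track a i false, MS)
    | IQuery _ _ _ => (q, a, MS)
    end
  | Some (Some b) => if wall then ((inord (next_pc pc b), None), a, MS) else (q, a, ML)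
  end.

Definition tmconf : Type := (nat * state * (nat -> data))%type.

Definition tset (tau : nat -> data) p a : nat -> data := fun k => if k == p then a else tau k.

Lemma tset_id tau p : tset tau p (tau p) = tau.
Proof. by apply: functional_extensionality => k; rewrite /tset; case: eqP => [->|]. Qed.

Definition tstep (x : tmconf) : tmconf :=
  let: (p, q, tau) := x in
  let: (q', a', mv) := delta q (p == 0) (tau p) in
  (match mv with ML => p.-1 | MS => p | MR => p.+1 end, q', tset tau p a').

Definition home (x : tmconf) := (x.1.1 == 0) && (x.1.2 == (ord0, None)).

Inductive reach : tmconf -> tmconf -> Prop :=
| reach1 x : reach x (tstep x)
| reachS x z : ~~ home (tstep x) -> reach (tstep x) z -> reach x z.

Lemma reach_trans x y z : reach x y -> ~~ home y -> reach y z -> reach x z.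
Proof.
move=> H; elim: H z => [{}x|{}x {}y nh _ IH] z nhy Hz; first exact: reachS.
by apply: reachS => //; apply: IH.
Qed.

Lemma reach_step x y : tstep x = y -> reach x y.
Proof. by move=> <-; apply: reach1. Qed.

Lemma reach_cons x y z : tstep x = y -> ~~ home y -> reach y z -> reach x z.
Proof. by move=> <-; apply: reachS. Qed.

Lemma reach_iter x y : reach x y -> exists2 n, 0 < n & y = iter n tstep x /\
  forall k, 0 < k < n -> ~~ home (iter k tstep x).
Proof.
elim=> [{}x|{}x z nh _ [n n0 [-> Hk]]]; first by exists 1 => //; split=> // k; lia.
exists n.+1 => //; split; first by rewrite -iterSr.
move=> [|[|k]] // lt; rewrite iterSr; apply: Hk; lia.
Qed.

Lemma not_home_phase p pc ph tau : ~~ home (p, (pc, Some ph), tau).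
Proof. by rewrite /home negb_and xpair_eqE andbF orbT. Qed.

Lemma reach_return p pc b tau :
  reach (p, (pc, Some (Some b)), tau) (0, (inord (next_pc pc b), None), tau).
Proof.
elim: p => [|p IH]; first by apply: reach_step; rewrite /= tset_id.
by apply: reach_cons IH; [rewrite /= tset_id | apply: not_home_phase].
Qed.

(** Cells beyond the first 0 are unconstrained, so any track with a 0 holds a register value. *)
Definition first0 (tau : nat -> data) i n :=
  (forall k, k < n -> track (tau k) i) /\ track (tau n) i = false.

Lemma reach_walk (pc : 'I_(size P).+1) i n tau z :
  (exists n0 n1, fetch pc = IQuery i n0 n1 \/ fetch pc = IDec i n0 n1) ->
  first0 tau i n -> reach (n, (pc, None), tau) z -> forall k, k <= n ->
  reach (k, (pc, None), tau) z.
Proof.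
move=> Hf [H1 _] Hz k le; rewrite -(subKn le); elim: (n - k) => [|d IH]; first by rewrite subn0.
case: (ltnP d n) => lt; last by rewrite (_ : n - d.+1 = n - d) //; lia.
apply: reach_cons IH; last by rewrite /home /=; lia.
have T : track (tau (n - d.+1)) i by apply: H1; lia.
have E : (n - d.+1).+1 = n - d by lia.
by move: Hf => [n0 [n1 [] Hf]]; rewrite /= Hf T /= tset_id E.
Qed.

Lemma reach_walk_copy (pc : 'I_(size P).+1) i j m n tau z : fetch pc = ICopy i j m ->
  first0 tau i n ->
  reach (n, (pc, None), fun k => if k < n then set_track (tau k) j true else tau k) z ->
  forall k, k <= n ->
  reach (k, (pc, None), fun l => if l < k then set_track (tau l) j true else tau l) z.
Proof.
move=> Hf [H1 _] Hz k le; rewrite -(subKn le); elim: (n - k) => [|d IH]; first by rewrite subn0.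
case: (ltnP d n) => lt; last by rewrite (_ : n - d.+1 = n - d) //; lia.
apply: reach_cons IH; last by rewrite /home /=; lia.
have T : track (tau (n - d.+1)) i by apply: H1; lia.
have E : (n - d.+1).+1 = n - d by lia.
rewrite /= Hf ltnn T /= E; congr (_, _, _).
apply: functional_extensionality => l; rewrite /tset.
case: eqP => [->|ne]; first by have -> : n - d.+1 < n - d by lia.
by have -> : (l < n - d.+1) = (l < n - d) by lia.
Qed.

Definition represents C0 (x : tmconf) (y : nat * (nat -> nat)) :=
  [/\ x.1 = (0, (inord y.1, None)), (forall i, i <= K -> first0 x.2 i (y.2 i)) &
      forall k, (x.2 k).1 = C0 k].

Lemma tset_if (tau : nat -> data) p a k :
  tset tau p a k = if k == p then a else tau k.
Proof. by []. Qed.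

Lemma represents_step C0 x pc s : represents C0 x (pc, s) -> pc < size P -> iok K (fetch pc) ->
  exists x', reach x x' /\ represents C0 x' (mstep P C0 (pc, s)).
Proof.
case: x => [pq tau] [/= -> Hr Hc] lt; set pc' := inord pc.
have Epc : pc' = pc :> nat by rewrite inordK // ltnS ltnW.
rewrite -/(fetch pc); case E: (fetch pc) => [i n0 n1|i j m|i nz np] /= Hi.
- exists (0, (inord (next_pc pc (C0 (s i))), None), tau).
  split; last by split=> //=; rewrite /next_pc E; case: (C0 _).
  have F := Hr i Hi.
  apply: (reach_walk (n := s i) _ F) => //.
    by exists n0, n1; left; rewrite Epc.
  apply: (@reach_cons _ (s i, (pc', Some (Some (C0 (s i)))), tau)); try exact: not_home_phase.
    by rewrite /= Epc E (F.2) /= tset_id Hc.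
  by rewrite -Epc; apply: reach_return.
- move/andP: Hi => [iK jK]; have F := Hr i iK; set n := s i in F *.
  pose tau1 k := if k < n then set_track (tau k) j true else tau k.
  pose tau2 := tset tau1 n (set_track (tau n) j true).
  pose tau3 := tset tau2 n.+1 (set_track (tau n.+1) j false).
  exists (0, (inord (next_pc pc false), None), tau3); split.
    apply: (@reach_walk_copy pc' i j m n tau _ _ F _ 0) => //.
      by rewrite Epc.
    apply: (@reach_cons _ (n.+1, (pc', Some None), tau2)); try exact: not_home_phase.
      by rewrite /= Epc E ltnn F.2 /= /tau2.
    apply: (@reach_cons _ (n.+1, (pc', Some (Some false)), tau3)); try exact: not_home_phase.
      rewrite /= Epc E /= /tau3 /tau2 /tau1 /tset /=.
      have -> : (n.+1 == n) = false by lia.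
      by have -> : (n.+1 < n) = false by lia.
    by rewrite -Epc; apply: reach_return.
  have T3 k : tau3 k = if k <= n then set_track (tau k) j true
      else if k == n.+1 then set_track (tau k) j false else tau k.
    rewrite /tau3 /tau2 /tau1 !tset_if; case: (ltngtP k n) => [lt1|lt1|->].
    + by have -> : (k == n.+1) = false by lia.
    + by case: eqP => // ->.
    + by have -> : (n == n.+1) = false by lia.
  split=> /=; first by rewrite /next_pc E.
    move=> k kK; rewrite /upd; case: (k =P j) => [->|ne].
      split=> [l ll|]; rewrite T3.
        by rewrite -ltnS ll track_set.
      by rewrite ltnn eqxx track_set.
    have [G1 G2] := Hr k kK; split=> [l ll|]; rewrite T3.
      by case: ifP => _; [|case: ifP => _]; rewrite ?track_set_other ?G1.
    by case: ifP => _; [|case: ifP => _]; rewrite ?track_set_other ?G2.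
  by move=> k; rewrite T3; case: ifP => _; [|case: ifP => _]; rewrite /= Hc.
- have F := Hr i Hi; case En: (s i) => [|n].
    exists (0, (inord nz, None), tau); split=> //; apply: reach_step.
    by move: F => [_]; rewrite En /= Epc E => -> /=; rewrite tset_id.
  rewrite En in F; pose tau1 := tset tau n (set_track (tau n) i false).
  exists (0, (inord (next_pc pc false), None), tau1); split.
    apply: (reach_walk (n := n.+1) _ F) => //.
      by exists nz, np; right; rewrite Epc.
    apply: (@reach_cons _ (n, (pc', Some None), tau)); try exact: not_home_phase.
      by rewrite /= Epc E F.2 /= tset_id.
    apply: (@reach_cons _ (n, (pc', Some (Some false)), tau1)); try exact: not_home_phase.
      by rewrite /= Epc E.
    by rewrite -Epc; apply: reach_return.
  split=> /=; first by rewrite /next_pc E.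
    move=> k kK; rewrite /upd; case: (k =P i) => [->|ne].
      split=> [l ll|]; rewrite /tau1 tset_if; last by rewrite eqxx track_set.
      have -> : (l == n) = false by lia.
      by apply: F.1; lia.
    have [G1 G2] := Hr k kK; split=> [l ll|]; rewrite /tau1 tset_if.
      by case: eqP => [<-|_]; rewrite ?track_set_other ?G1.
    by case: eqP => [<-|_]; rewrite ?track_set_other ?G2.
  by move=> k; rewrite /tau1 tset_if; case: eqP => [->|_]; rewrite /= Hc.
Qed.

Lemma represents_nothome C0 x pc s : represents C0 x (pc, s) -> 0 < pc < size P -> ~~ home x.
Proof.
case: x => [pq tau] [/= -> _ _] lt; rewrite /home /=.
by apply/negP => /eqP [] /(congr1 val) /=; rewrite inordK; lia.
Qed.

Lemma mrun_reach C0 x y z : (forall i, iok K (fetch i)) -> mrun P C0 y z -> represents C0 x y ->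
  exists x', reach x x' /\ represents C0 x' z.
Proof.
move=> Hok H; elim: H x => [[pc s] lt|[pc s] {}z lt H1 IH] x Hx.
  by apply: represents_step => //; move/andP: lt => [].
have [x1 [R1 Hx1]] : exists x', reach x x' /\ represents C0 x' (mstep P C0 (pc, s)).
  by apply: represents_step => //; move/andP: lt => [].
have [x2 [R2 Hx2]] := IH _ Hx1; exists x2; split=> //.
apply: (reach_trans R1 _ R2); move: Hx1; case E: (mstep P C0 (pc, s)) H1 => [pc1 s1] H1 Hx1.
by apply: (represents_nothome Hx1); inversion H1.
Qed.

Definition inf_often (W : tmconf -> Prop) x := forall N, exists2 k, N <= k & W (iter k tstep x).

Lemma inf_often_iter W n x : inf_often W x -> inf_often W (iter n tstep x).
Proof.
move=> H N; have [k le Hk] := H (n + N); exists (k - n); first lia.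
by rewrite -iterD subnK //; lia.
Qed.

(* If track i carried no 0, the head would walk to the right forever. *)
Lemma probe_first0 pc i n0 n1 tau : fetch pc = IQuery i n0 n1 -> pc < size P ->
  inf_often home (0, (inord pc, None), tau) -> exists n, first0 tau i n.
Proof.
move=> Hf lt Hinf.
case: (excluded_middle_informative (exists n, ~~ track (tau n) i)) => [ex|nex].
  exists (ex_minn ex); case: ex_minnP => n Hn Hmin; split=> [k ltk|]; last exact: negbTE.
  by apply/negPn/negP => /Hmin; rewrite leqNgt ltk.
have [[|k] // _] := Hinf 1.
suff -> : iter k.+1 tstep (0, (inord pc, None), tau) = (k.+1, (inord pc, None), tau) by [].
elim: k.+1 => //= m ->; rewrite /= inordK ?ltnS ?(ltnW lt) // Hf.
case T: (track _ _); first by rewrite /= tset_id.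
by case: nex; exists m; rewrite T.
Qed.

(** After a successful probe the head is back at the wall with the next address and an unchanged
    tape, from where home still recurs. *)
Lemma probes_first0 pc tau :
  (forall i, i <= K -> fetch i = IQuery i i.+1 i.+1) -> K < size P ->
  inf_often home (0, (inord pc, None), tau) ->
  forall i, pc <= i <= K -> exists n, first0 tau i n.
Proof.
move=> Hf KP; elim: {pc}(K.+1 - pc) {-2}pc (leqnn (K.+1 - pc)) => [|d IH] pc le Hinf i; first lia.
move=> /andP[]; rewrite leq_eqVlt => /predU1P[<- iK|lt iK].
  by apply: probe_first0 Hinf => //; [apply: Hf | lia].
have [n [F1 F2]] : exists n, first0 tau pc n.
  by apply: probe_first0 Hinf => //; [apply: Hf|]; lia.
apply: (IH pc.+1); [lia | | lia].
have R : reach (0, (inord pc, None), tau) (0, (inord pc.+1, None), tau).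
  have Epc : @inord (size P) pc = pc :> nat by rewrite inordK; lia.
  have Fp : fetch (@inord (size P) pc) = IQuery pc pc.+1 pc.+1 by rewrite Epc Hf //; lia.
  apply: (reach_walk (n := n) (i := pc) (tau := tau)) => //.
    by exists pc.+1, pc.+1; left.
  apply: (@reach_cons _ (n, (inord pc, Some (Some (tau n).1)), tau)); try exact: not_home_phase.
    by rewrite /= Fp F2 /= tset_id.
  rewrite (_ : pc.+1 = next_pc (@inord (size P) pc) (tau n).1); first exact: reach_return.
  by rewrite /next_pc Fp if_same.
have [m _ [-> _]] := reach_iter R; exact: inf_often_iter.
Qed.

End Machine.

(** * Recurrence of the window on the machine *)


Definition wdata K w (k : nat) : data K :=
  (false, [ffun i : 'I_K.+1 => ~~ ((i == ord0) && (k == w.+1))]).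

Definition tmwin P K w (x : tmconf P K) :=
  home x /\ forall k, k < w.+2 -> x.2 k = wdata K w k.

Lemma track_wdata K w k i : i <= K -> track (wdata K w k) i = ~~ ((i == 0) && (k == w.+1)).
Proof. by move=> iK; rewrite /track ffunE -val_eqE /= inordK. Qed.

(** The first 0 of a track lies at its register value, so the [w + 2] window cells carry only 1s iff
    that value is at least [w + 2]. *)
Lemma represents_tmwin P K C0 (x : tmconf P K) s w : represents C0 x (0, s) -> s 0 = w.+1 ->
  (forall k, k < w.+2 -> C0 k = false) ->
  (tmwin w x <-> forall i, 0 < i <= K -> w.+2 <= s i).
Proof.
case: x => [[p q] tau] [/= [-> ->] Hr Hc] s0 C00; split=> [[_ /= Hw] i iK|Hs].
  have [_ Hi] := Hr i ltac:(lia); rewrite leqNgt; apply/negP => lt.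
  by move: Hi; rewrite Hw // track_wdata; lia.
split=> [|k lt] /=.
  by rewrite /home /= xpair_eqE -val_eqE /= inordK.
have F i : i <= K -> track (tau k) i = track (wdata K w k) i.
  move=> iK; rewrite track_wdata //; case: (posnP i) => [->|i0] /=.
    have [H1 H2] := Hr 0 isT; rewrite s0 in H1 H2.
    by case: eqP => [->|ne] //=; apply: H1; lia.
  have [H1 _] := Hr i iK; apply: H1; apply: leq_trans lt (Hs _ _); lia.
have := Hc k; rewrite (C00 _ lt); case: (tau k) F => [b g] /= F ->; congr (_, _).
apply/ffunP => i; have := F i (ltn_ord i).
by rewrite /track /= inord_val.
Qed.

Section Main.
Variables (e : rfun) (K w : nat) (G : (nat -> bool) -> nat -> nat -> nat).
Hypotheses (K5 : 5 <= K) (He : cok K (CCheck e)).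
Hypothesis HG : forall C m l, reval C e [:: m; l; w.+1] (G C m l).
Notation P := (prog e K).

Lemma fetch_probe i : i <= K -> fetch P i = IQuery i i.+1 i.+1.
Proof.
by move=> iK; rewrite /fetch nth_cat size_mkseq ltnS iK nth_mkseq.
Qed.

Lemma size_prog : K.+1 < size P.
Proof. by rewrite size_cat size_mkseq size_code /=; lia. Qed.

Lemma body_reach C0 x s s' : represents (P := P) (K := K) C0 x (0, s) -> exec C0 (CBody e K) s s' ->
  exists x', reach x x' /\ represents C0 x' (0, s').
Proof.
move=> Hx Hex; have Hok i : iok K (fetch P i) by apply: prog_iok.
have sP := size_prog.
have M : mrun P C0 (K.+1, s) (0, s').
  apply: exec_mrun Hex _ _ _ _ => //.
  by exists (mkseq (fun i => IQuery i i.+1 i.+1) K.+1), [::]; rewrite cats0 size_mkseq.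
have M1 d : d <= K -> mrun P C0 (K.+1 - d, s) (0, s').
  elim: d => [|d IH] dK; first by rewrite subn0.
  have lt : 0 < K.+1 - d.+1 < size P by lia.
  apply: (@mrunS P C0 (K.+1 - d.+1, s) _ lt); rewrite /mstep -/(fetch P _) fetch_probe; last lia.
  by rewrite if_same (_ : (K.+1 - d.+1).+1 = K.+1 - d); [apply: IH|]; lia.
have [x1 [R1 X1]] := represents_step Hx (ltn_trans (ltn0Sn K) sP) (Hok 0).
have {}X1 : represents C0 x1 (1, s) by move: X1; rewrite /mstep -/(fetch P 0) fetch_probe // if_same.
have M2 : mrun P C0 (1, s) (0, s') by have := M1 K (leqnn K); rewrite subSnn.
have [x2 [R2 X2]] := mrun_reach Hok M2 X1.
by exists x2; split=> //; apply: reach_trans R1 _ R2; apply: (represents_nothome X1); lia.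
Qed.

(** One pass of the program. No home configuration lies strictly inside it, so the window can occur
    only at its ends. Success is sure to show the window only if registers 2 and 3, which are not
    refilled, are large enough. *)
Lemma tm_next C C0 (x : tmconf P K) s : (forall n, C n = C0 (n + w.+2)) ->
  (forall k, k < w.+2 -> C0 k = false) ->
  represents C0 x (0, s) -> s 0 = w.+1 -> exists x' s' n, [/\ 0 < n, x' = iter n (@tstep P K) x,
    (forall k, 0 < k < n -> ~~ home (iter k (@tstep P K) x)), represents C0 x' (0, s') & [/\ s' 0 = w.+1,
    (G C (s 2) (s 3) = 0 -> [/\ s' 2 = (s 2).+1, s' 3 = s 3 &
        w.+2 <= s 2 -> w.+2 <= s 3 -> tmwin w x']) &
    (G C (s 2) (s 3) <> 0 -> [/\ s' 2 = s 2, s' 3 = (s 3).+1 & ~ tmwin w x'])]].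
Proof.
move=> HC C00 Hx s0.
have [s' [Hex s0' Hsucc Hfail Hfill]] := @exec_body C C0 w.+1 K e s _ K5 HC s0 (HG C (s 2) (s 3)).
have [x' [R Hx']] := body_reach Hx Hex; have [n n0 [En Hn]] := reach_iter R.
exists x', s', n; split=> //; split=> // g0.
  have [E2 E3 E4] := Hsucc g0; split=> // le2 le3.
  apply/(represents_tmwin Hx' s0' C00) => i iK.
  have [|] := ltnP i 5; last by move=> le; rewrite Hfill //; [lia|right].
  case: i iK => [|[|[|[|[|i]]]]] // iK _; rewrite ?E2 ?E3 ?E4 //; first by rewrite Hfill; [|lia|left].
  by lia.
have [E2 E3 E4] := Hfail g0; split=> // /(represents_tmwin Hx' s0' C00) /(_ 4).
by rewrite E4; lia.
Qed.

(** The window fixes register 0, the probes give values to the other registers, and the oracle is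
    read off the tape beyond the window. Every return of the window requires a successful pass,
    which raises register 2; so the checked [m] is unbounded, whatever the initial values. *)
Lemma tm_sound tau :
  inf_often (tmwin w) ((0, (ord0, None), tau) : tmconf P K) -> tmwin w ((0, (ord0, None), tau) : tmconf P K) ->
  exists C, forall d, exists m l, d <= m /\ G C m l = 0.
Proof.
set x : tmconf P K := (0, _, _) => Hinf Hw.
have [s Hs] : exists s : nat -> nat, forall i, i <= K -> first0 tau i (s i).
  apply: functional_choice (fun i n => i <= K -> first0 tau i n) _ => i.
  case: (leqP i K) => iK; last by exists 0.
  have [||n Hn] := @probes_first0 P K 0 tau fetch_probe (ltnW size_prog) _ i; last by exists n.
    have -> : inord 0 = ord0 :> 'I_(size P).+1 by apply: val_inj; rewrite /= inordK.
    by move=> N; have [k le [Hk _]] := Hinf N; exists k.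
  by [].
have Hw2 : forall k, k < w.+2 -> tau k = wdata K w k := Hw.2.
pose C0 k := (tau k).1; pose C n := C0 (n + w.+2).
have Hx : represents C0 x (0, s).
  split=> //=; congr (_, (_, _)); apply: val_inj; by rewrite /= inordK.
have C00 k : k < w.+2 -> C0 k = false by move=> lt; rewrite /C0 (Hw2 k lt).
have s0 : s 0 = w.+1.
  have [H1 H2] := Hs 0 isT; case: (ltngtP (s 0) w.+1) => // lt.
    by move: H2; rewrite Hw2 ?track_wdata //; lia.
  by have := H1 _ lt; rewrite Hw2 // track_wdata // !eqxx.
exists C.
(* A failed pass ends without the window, hence strictly before [N]; induction on the remaining time
   reaches a successful pass. *)
have next N : forall x s, represents C0 x (0, s) -> s 0 = w.+1 -> 0 < N -> tmwin w (iter N (@tstep P K) x) ->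
  exists s' n l, [/\ represents C0 (iter n (@tstep P K) x) (0, s'), s' 0 = w.+1, s' 2 = (s 2).+1 &
    G C (s 2) l = 0].
  have [n] := ubnP N; elim: n N => // n IH N ltN {Hinf Hw Hw2 Hs Hx s0}x {}s Hx s0 N0 HN.
  have [x' [s' [k [k0 Ek Hk Hx' [s0' Hsucc Hfail]]]]] := tm_next (C := C) (fun=> erefl) C00 Hx s0.
  have kN : k <= N.
    by rewrite leqNgt; apply/negP => lt; have := Hk N; rewrite N0 lt HN.1 => /(_ isT).
  case: (eqVneq (G C (s 2) (s 3)) 0) => [g0|/eqP g0].
    by have [E2 _ _] := Hsucc g0; exists s', k, (s 3); rewrite -Ek; split.
  have [E2 E3 nw] := Hfail g0.
  have ltk : k < N.
    by rewrite ltn_neqAle kN andbT; apply/eqP => E; apply: nw; rewrite Ek E.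
  have [|||||s'' [m [l [H1 H2 H3 H4]]]] := IH (N - k) _ x' s' => //; try lia.
    by rewrite Ek -iterD subnK.
  exists s'', (m + k), l; rewrite E2 in H3 H4; split=> //.
  by rewrite iterD -Ek.
have iterate d : exists s' n, [/\ represents C0 (iter n (@tstep P K) x) (0, s'), s' 0 = w.+1 & d <= s' 2].
  elim: d => [|d [s' [n [H1 H2 H3]]]]; first by exists s, 0.
  have [N N0 HN] := inf_often_iter n Hinf 1.
  have [s'' [m [l [E1 E2 E3 _]]]] := next N _ _ H1 H2 N0 HN.
  by exists s'', (m + n); rewrite iterD E3.
move=> d; have [s' [n [H1 H2 H3]]] := iterate d.
have [N N0 HN] := inf_often_iter n Hinf 1.
have [s'' [m [l [E1 E2 E3 E4]]]] := next N _ _ H1 H2 N0 HN.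
by exists (s' 2), l.
Qed.

(** Failed passes keep register 2 and raise register 3, until by hypothesis a pass succeeds. Neither
    register decreases from pass to pass, so both stay at least [w + 2] and every success shows the
    window. *)
Lemma tm_complete C : (forall m, exists l0, forall l, l0 <= l -> G C m l = 0) ->
  exists tau, inf_often (tmwin w) ((0, (ord0, None), tau) : tmconf P K).
Proof.
move=> HCG.
(* Beyond the window all tracks are 0, so every register but 0 starts at [w + 2]; the oracle bits
   are shifted past the window. *)
pose tau k : data K := if k < w.+2 then wdata K w k else (C (k - w.+2), [ffun=> false]).
exists tau; set x : tmconf P K := (0, _, _).
pose C0 k := (tau k).1; pose s i := if i is 0 then w.+1 else w.+2.
have HC n : C n = C0 (n + w.+2) by rewrite /C0 /tau ltnNge leq_addl addnK.
have C00 k : k < w.+2 -> C0 k = false by move=> lt; rewrite /C0 /tau lt.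
have Hx : represents C0 x (0, s).
  split=> //=; first by congr (_, (_, _)); apply: val_inj; rewrite /= inordK.
  move=> i iK; split=> [k lt|].
    have -> : tau k = wdata K w k by rewrite /tau ifT //; case: i lt {iK} => [|i] /=; lia.
    by rewrite track_wdata //; case: i lt {iK} => //=; lia.
  case: i iK => [|i] iK /=; first by rewrite /tau ltnSn track_wdata // !eqxx.
  by rewrite /tau ltnn /track /= ffunE.
have next n : forall x s, represents C0 x (0, s) -> s 0 = w.+1 -> w.+2 <= s 2 -> w.+2 <= s 3 ->
  (forall l, s 3 + n <= l -> G C (s 2) l = 0) ->
  exists s' k, [/\ 0 < k, represents C0 (iter k (@tstep P K) x) (0, s'),
    tmwin w (iter k (@tstep P K) x) & [/\ s' 0 = w.+1, w.+2 <= s' 2 & w.+2 <= s' 3]].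
  elim: n => [|n IH] {Hx}x {}s Hx s0 s2 s3 Hl;
    have [x' [s' [k [k0 Ek _ Hx' [s0' Hsucc Hfail]]]]] := tm_next HC C00 Hx s0.
    have [E2 E3 Hwin] := Hsucc (Hl (s 3) ltac:(lia)).
    by exists s', k; rewrite -Ek; split=> //; [exact: Hwin | split=> //; lia].
  case: (eqVneq (G C (s 2) (s 3)) 0) => [g0|/eqP g0].
    have [E2 E3 Hwin] := Hsucc g0.
    by exists s', k; rewrite -Ek; split=> //; [exact: Hwin | split=> //; lia].
  have [E2 E3 _] := Hfail g0.
  have [||||s'' [m [m0 H1 H2 H3]]] := IH x' s' Hx' => //; try by rewrite ?E2 ?E3; lia.
    by move=> l le; rewrite E2; apply: Hl; lia.
  exists s'', (m + k); rewrite iterD -Ek; split=> //; lia.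
move=> N.
suff [k [s' [le Hk1 Hk2 _]]] : exists k s', [/\ N <= k, tmwin w (iter k (@tstep P K) x),
    represents C0 (iter k (@tstep P K) x) (0, s') & [/\ s' 0 = w.+1, w.+2 <= s' 2 & w.+2 <= s' 3]].
  by exists k.
elim: N => [|N [k [s' [le Hk1 Hk2 [E0 E2 E3]]]]].
  exists 0, s; split=> //=; apply/(represents_tmwin Hx) => // -[|i] //=.
have [l0 Hl0] := HCG (s' 2).
have [|s'' [m [m0 H1 H2 H3]]] := next l0 _ _ Hk2 E0 E2 E3; first by move=> l ll; apply: Hl0; lia.
by exists (m + k), s''; rewrite iterD; split=> //; lia.
Qed.

End Main.

(** * The cellular automaton *)


Definition ca (S : Type) (loc : S -> S -> S -> S) (x : config S) : config S :=
  fun i => loc (x (i - 1)%Z) (x i) (x (i + 1)%Z).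

Lemma ca_cellular_automaton (S : Type) (loc : S -> S -> S -> S) : cellular_automaton (ca loc).
Proof.
split=> [x n|x i]; last first.
  have E : (i - 1 + 1 = i + 1 - 1)%Z by lia.
  by rewrite /ca /Defs.shift E.
by exists n.+1 => y Hy i Hi; rewrite /ca !Hy //; lia.
Qed.

Section MachineCA.
Variables (P : seq instr) (K : nat).

(* Wall flag, head or direction towards the head (true: to the right), tape data. *)
Definition cell : Type := (bool * (state P + bool) * data K)%type.

Definition moves_right (c : cell) : option (state P) :=
  if c.1.2 is inl q then
    let: (q', _, mv) := delta q c.1.1 c.2 in if mv is MR then Some q' else None
  else None.

Definition moves_left (c : cell) : option (state P) :=
  if c.1.2 is inl q then
    let: (q', _, mv) := delta q c.1.1 c.2 in
    if mv is ML then if c.1.1 then None else Some q' else None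
  else None.

(* A head moving right takes over any cell and erases its wall. As the wall of a recurring
   window persists, no head ever enters the half-line from the left. *)
Definition loc (l c r : cell) : cell :=
  if moves_right l is Some q' then (false, inl q', c.2) else
  match c.1.2 with
  | inl q => let: (q', a', mv) := delta q c.1.1 c.2 in
    match mv with
    | MR => (c.1.1, inr true, a')
    | ML => (c.1.1, if c.1.1 then inl q' else inr false, a')
    | MS => (c.1.1, inl q', a')
    end
  | inr true => if moves_left r is Some q' then (c.1.1, inl q', c.2) else c
  | inr false => c
  end.

Lemma loc_left l l' c r : moves_right l = moves_right l' -> loc l c r = loc l' c r.
Proof. by rewrite /loc => ->. Qed.

Lemma loc_right l c r r' : c.1.2 <> inr true -> loc l c r = loc l c r'.
Proof. by rewrite /loc; case: (moves_right l) => //; case: (c.1.2) => [q|[]]. Qed.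

(** Walls are never created, and a head entering from the left destroys one; so a wall seen after a
    step was there before it and was not crossed. *)
Lemma wall_loc l c r : (loc l c r).1.1 -> c.1.1 /\ moves_right l = None.
Proof.
rewrite /loc; case: (moves_right l) => //; case: (c.1.2) => [q|[]] //.
  by case: (delta _ _ _) => [[q' a'] []].
by case: (moves_left r).
Qed.

(** The mark [inr false] lets a cell accept heads only from the left, so blank cells to the left of
    a wall stay blank. *)
Definition blank : cell := (false, inr false, (false, [ffun=> false])).

Definition cellat (x : tmconf P K) k : cell :=
  (k == 0, if k == x.1.1 then inl x.1.2 else inr (k < x.1.1), x.2 k).

Definition leftcell x k := if k is k'.+1 then cellat x k' else blank.

Lemma loc_cellat x k : loc (leftcell x k) (cellat x k) (cellat x k.+1) = cellat (tstep x) k.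
Proof.
case: x => [[p q] tau].
have HL k' : moves_left (cellat (p, q, tau) k') =
   if k' == p then moves_left (cellat (p, q, tau) p) else None.
  by case: eqP => [->//|/eqP/negPf ne]; rewrite /moves_left /= ne.
have HR k' : moves_right (leftcell (p, q, tau) k') =
   if k' == p.+1 then moves_right (cellat (p, q, tau) p) else None.
  by case: k' => [|k'] //=; rewrite eqSS; case: eqP => [->//|/eqP/negPf ne]; rewrite /moves_right /= ne.
rewrite /loc HR HL; case E: (delta q (p == 0) (tau p)) => [[q' a'] mv].
have Er : moves_right (cellat (p, q, tau) p) = if mv is MR then Some q' else None.
  by rewrite /moves_right /= eqxx E.
have El : moves_left (cellat (p, q, tau) p) =
    if mv is ML then if p == 0 then None else Some q' else None.
  by rewrite /moves_left /= eqxx E.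
rewrite Er El /tstep E /cellat /= /tset.
case: (ltngtP k p) => [lt|lt|->].
- have -> : (k == p.+1) = false by lia.
  case: mv E {Er El HL HR} => E.
  + case: eqP => [ep|ne].
      have -> : (p == 0) = false by lia.
      by have -> : (k == p.-1) by lia.
    have -> : (k == p.-1) = false by lia.
    by have -> : (k < p.-1) by lia.
  + have -> : (k == p) = false by lia.
    by rewrite if_same lt.
  + have -> : (k == p.+1) = false by lia.
    by rewrite if_same ltnS ltnW.
- case: eqP => [ek|ne].
    have -> : (k == 0) = false by lia.
    case: mv E {Er El HL HR} => E.
    + have -> : (k == p.-1) = false by lia.
      by have -> : (k < p.-1) = false by lia.
    + have -> : (k == p) = false by lia.
      by have -> : (k < p) = false by lia.
    + by rewrite ek eqxx.
  case: mv E {Er El HL HR} => E.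
  + have -> : (k == p.-1) = false by lia.
    by have -> : (k < p.-1) = false by lia.
  + have -> : (k == p) = false by lia.
    by have -> : (k < p) = false by lia.
  + have -> : (k == p.+1) = false by lia.
    by have -> : (k < p.+1) = false by lia.
- have -> : (p == p.+1) = false by lia.
  rewrite ?eqxx /= E; case: mv E {Er El HL HR} => E.
  + case: (posnP p) => [->|p0] //.
    have -> : (p == p.-1) = false by lia.
    by have -> : (p < p.-1) = false by lia.
  + by rewrite eqxx.
  + by rewrite ltnSn; have -> : (p == p.+1) = false by lia.
Qed.

Definition embed (x : tmconf P K) : config cell :=
  fun i => if (i <? 0)%Z then blank else cellat x (Z.to_nat i).

Lemma ca_embed x : ca loc (embed x) = embed (tstep x).
Proof.
apply: functional_extensionality => i; rewrite /ca /embed.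
case: Z.ltb_spec => lt; case: Z.ltb_spec => lt1; case: Z.ltb_spec => lt2; try lia; try done.
- have -> : i = 0%Z by lia.
  exact: (loc_cellat x 0).
- have -> : Z.to_nat (i + 1) = (Z.to_nat i).+1 by lia.
  by rewrite -loc_cellat; case E: (Z.to_nat i) => [|k] /=; [lia|congr (loc (cellat _ _)); lia].
Qed.

Lemma iter_ca_embed k x : iter k (ca loc) (embed x) = embed (iter k (@tstep P K) x).
Proof. by elim: k => //= k ->; rewrite ca_embed. Qed.

(* A head coming from another wall may keep modifying cells that the head of this wall has
   not visited yet, so the tape is taken to hold in cell k what the head finds there on its
   first visit. *)
Lemma tape_exists (c : nat -> config cell) q0 r0 tau0 :
  (forall t, c t.+1 = ca loc (c t)) -> (forall t, (c t 0%Z).1.1) ->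
  (forall k, k <= r0 -> c 0 (Z.of_nat k) = cellat (0, q0, tau0) k) ->
  exists tau, (forall k, k <= r0 -> tau k = tau0 k) /\
    forall t k, k <= r0 ->
      c t (Z.of_nat k) = cellat (iter t (@tstep P K) (0, q0, tau)) k.
Proof.
move=> Hc Hwall H0.
(* [r t] is the frontier of the cells known to follow the machine; it advances when a head leaves it
   to the right. *)
pose r := fix r t := if t is t'.+1 then
  (if moves_right (c t' (Z.of_nat (r t'))) is Some _ then (r t').+1 else r t') else r0.
have rmono t d : r t <= r (t + d).
  by elim: d => [|d IH]; rewrite ?addn0 // addnS /=; case: (moves_right _) => *; lia.
(* [T k] is the time at which the frontier first reaches cell [k], and [V k] is what the cell holds
   then. For cells never reached the value 0 is arbitrary. *)
pose T k := match excluded_middle_informative (exists t, k <= r t) with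
  | left ex => ex_minn ex | right _ => 0 end.
pose V k := (c (T k) (Z.of_nat k)).2.
have TE k t : k <= r t -> (forall t', t' < t -> r t' < k) -> T k = t.
  move=> le Hlt; rewrite /T; case: excluded_middle_informative => [ex|[]]; last by exists t.
  case: ex_minnP => m lem Hm; apply/eqP; rewrite eqn_leq (Hm _ le) leqNgt.
  by apply/negP => /Hlt; rewrite ltnNge lem.
have V0 k : k <= r0 -> V k = tau0 k.
  by move=> le; rewrite /V (TE k 0) // H0.
exists V; split=> //.
pose X t := iter t (@tstep P K) (0, q0, V).
have Inv t : [/\ (X t).1.1 <= r t, forall k, k <= r t -> c t (Z.of_nat k) = cellat (X t) k &
    forall k, r t < k -> (X t).2 k = V k].
  elim: t => [|t [I1 I2 I3]].
    by split=> // k le; rewrite H0 // /cellat /= V0.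
  have St k : k <= r t -> c t.+1 (Z.of_nat k) = cellat (X t.+1) k.
    move=> le; rewrite /X iterS -loc_cellat -/(X t) Hc /ca.
    have -> : (Z.of_nat k + 1 = Z.of_nat k.+1)%Z by lia.
    rewrite (@loc_left _ (leftcell (X t) k)); last first.
      case: k le => [|k] le; last first.
        have -> : (Z.of_nat k.+1 - 1 = Z.of_nat k)%Z by lia.
        by rewrite I2 // ltnW.
      by have := Hwall t.+1; rewrite Hc => /wall_loc [_ ->].
    rewrite I2 //; move: le; rewrite leq_eqVlt => /predU1P[->|lt]; last by rewrite I2.
    (* The frontier cell either carries the head or records it on the left; in both cases the rule
       ignores the right neighbour, about which nothing is known. *)
    by apply: loc_right => /=; case: eqP => // _ []; rewrite ltnNge I1.
  have Er : r t.+1 = if moves_right (cellat (X t) (r t)) is Some _ then (r t).+1 else r t.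
    by rewrite /= I2.
  case Ex: (X t) (I1) (I3) => [[p q] tau] Ip It; rewrite [_.1.1]/= in Ip; rewrite [_.2]/= in It.
  have EX : X t.+1 = tstep (p, q, tau) by rewrite /X iterS -/(X t) Ex.
  case Ed: (delta q (p == 0) (tau p)) => [[q' a'] mv].
  have {}EX : X t.+1 = (match mv with ML => p.-1 | MS => p | MR => p.+1 end, q', tset tau p a').
    by rewrite EX /tstep Ed.
  case: (eqVneq (r t) p) => [erp|nrp]; last first.
    have {}Er : r t.+1 = r t by rewrite Er /moves_right Ex /= (negPf nrp).
    rewrite Er; split=> //; first by rewrite EX /=; case: mv {EX Ed} => /=; lia.
    move=> k lt; rewrite EX /= /tset; have -> : (k == p) = false by lia.
    by rewrite It.
  have {}Er : r t.+1 = if mv is MR then p.+1 else p.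
    by rewrite Er /moves_right Ex erp /= eqxx Ed; case: (mv).
  rewrite -/(r t.+1); have mon := rmono t 1; rewrite addn1 in mon.
  split.
  - by rewrite Er EX; case: (mv) => /=; lia.
  - move=> k; rewrite Er => le; case: (leqP k (r t)) => lek; first exact: St.
    case: mv Er EX Ed le => Er EX Ed le; try by lia.
    have ek : k = p.+1 by lia.
    have Ek : c t.+1 (Z.of_nat k) = (false, inl q', (c t (Z.of_nat k)).2).
      rewrite Hc /ca (_ : (Z.of_nat k - 1 = Z.of_nat p)%Z); last lia.
      by rewrite I2 -?erp // Ex /loc /moves_right /= erp eqxx Ed.
    rewrite Ek /cellat EX /= ek eqxx /= /tset; have -> : (p.+1 == p) = false by lia.
    congr (_, _); rewrite It ?erp // /V (TE p.+1 t.+1).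
    + by have := congr1 snd Ek; rewrite ek.
    + by rewrite Er.
    + move=> t' lt'; have := rmono t' (t - t'); rewrite subnKC; last lia.
      by rewrite erp; lia.
  - move=> k lt; rewrite EX /= /tset; have -> : (k == p) = false by move: lt; rewrite Er; case: (mv); lia.
    by rewrite It //; lia.
by move=> t k le; have [_ H _] := Inv t; apply: H; apply: leq_trans le (rmono 0 t).
Qed.

Definition home_state : state P := (ord0, None).

Definition window w : seq cell :=
  [seq cellat (0, home_state, wdata K w) k | k <- iota 0 w.+2].

Lemma cellat_tmwin x w : (forall k, k < w.+2 ->
   cellat x k = cellat (0, home_state, wdata K w) k) <-> tmwin w x.
Proof.
case: x => [[p q] tau]; split=> [H|[/andP[/= /eqP -> /eqP ->] H] k lt]; last first.
  by rewrite /cellat /= H.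
have [E _] := H 0 isT; split=> [|k lt] /=; last by have [_] := H k lt.
by move: E; case: p {H} => // -[->]; rewrite /home /= eqxx.
Qed.

Lemma ca_window_recurs w :
  (exists x, forall N, exists2 k, N <= k & forall i, i < w.+2 ->
      iter k (ca loc) x (Z.of_nat i) = cellat (0, home_state, wdata K w) i) <->
  exists2 tau, inf_often (tmwin w) ((0, home_state, tau) : tmconf P K) &
    tmwin w ((0, home_state, tau) : tmconf P K).
Proof.
split=> [[x Hx]|[tau Hinf _]]; last first.
  exists (embed (0, home_state, tau)) => N; have [k le /cellat_tmwin Hk] := Hinf N.
  exists k => // i lt; rewrite iter_ca_embed -Hk // /embed.
  by case: Z.ltb_spec; [lia|rewrite Nat2Z.id].
have [k0 _ H0] := Hx 0; pose c t := iter (t + k0) (ca loc) x.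
(* Each time precedes some occurrence of the window, whose wall must have existed at all earlier
   times. *)
have Hwall t : (c t 0%Z).1.1.
  have [k le Hk] := Hx (t + k0).
  have : (iter k (ca loc) x 0%Z).1.1 by rewrite (Hk 0).
  rewrite -(subnK le) iterD -/(c t); elim: (k - _) => //= d IH /wall_loc [H _].
  exact: IH.
have [//|tau [Et Ht]] := @tape_exists c home_state w.+1 (wdata K w) _ Hwall H0.
exists tau => [N|]; last by apply/cellat_tmwin => k lt; rewrite /cellat /= Et.
have [k le Hk] := Hx (N + k0); exists (k - k0); first lia.
apply/cellat_tmwin => i lt; rewrite -Ht // /c subnK; last lia.
exact: Hk.
Qed.

End MachineCA.

(** * Hardness *)


Lemma inf_pigeonhole (T : finType) (F : nat -> T) (Q : nat -> Prop) :
  (forall N, exists2 k, N <= k & Q k) ->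
  exists t, forall N, exists2 k, N <= k & Q k /\ F k = t.
Proof.
move=> Hinf; case: (classic (exists t, forall N, exists2 k, N <= k & Q k /\ F k = t)) => // H.
have [M HM] : exists M : T -> nat, forall t k, M t <= k -> Q k -> F k <> t.
  apply: (functional_choice (fun t M => forall k, M <= k -> Q k -> F k <> t)) => t.
  case: (classic (exists M, forall k, M <= k -> Q k -> F k <> t)) => // H1.
  case: H; exists t => N; case: (classic (exists2 k, N <= k & Q k /\ F k = t)) => // H2.
  by case: H1; exists N => k le Qk E; apply: H2; exists k.
have [k le Qk] := Hinf (\max_t M t).
by case: (HM (F k) k) => //; apply: leq_trans le; apply: leq_bigmax.
Qed.

Definition occurs (S : Type) (u : seq S) (x : config S) :=
  u = [seq x (Z.of_nat i) | i <- iota 0 (size u)].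

Lemma occurs_agree (S : Type) (u : seq S) x y : agree_on (size u) x y -> occurs u y -> occurs u x.
Proof.
rewrite /occurs => H ->; rewrite size_map size_iota; apply/eq_in_map => i.
by rewrite mem_iota => lt; apply/esym/H; lia.
Qed.

(** Compactness of the full shift: by pigeonhole, a pattern on [[-m, m]] shared by infinitely many
    [g k] with [Q k] extends to [[-m-1, m+1]]. *)
Lemma konig (S : finType) (g : nat -> config S) (Q : nat -> Prop) :
  (forall N, exists2 k, N <= k & Q k) ->
  exists y, forall m N, exists2 k, N <= k & Q k /\ agree_on m (g k) y.
Proof.
move=> Hinf; pose Inf m y := forall N, exists2 k, N <= k & Q k /\ agree_on m (g k) y.
have [a Ha] := inf_pigeonhole (fun k => g k 0%Z) Hinf.
have I0 : Inf 0 (fun=> a).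
  move=> N; have [k le [Qk E]] := Ha N; exists k => //; split=> // i Hi.
  by have -> : i = 0%Z by lia.
have [h Hh] : exists h : nat * config S -> config S, forall my, Inf my.1 my.2 ->
    agree_on my.1 (h my) my.2 /\ Inf my.1.+1 (h my).
  apply: (functional_choice (fun my y' => Inf my.1 my.2 ->
     agree_on my.1 y' my.2 /\ Inf my.1.+1 y')) => -[m y] /=.
  case: (classic (Inf m y)) => [Hy|]; last by exists y.
  have [[b c] Hbc] := inf_pigeonhole
    (fun k => (g k (- Z.of_nat m.+1)%Z, g k (Z.of_nat m.+1))) Hy.
  exists (fun i => if (i =? - Z.of_nat m.+1)%Z then b else
                   if (i =? Z.of_nat m.+1)%Z then c else y i) => _; split.
    by move=> i Hi; case: Z.eqb_spec => [|_]; [lia|]; case: Z.eqb_spec => [|_]; [lia|].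
  move=> N; have [k le [[Qk Ak] [E1 E2]]] := Hbc N; exists k => //; split=> // i Hi.
  case: Z.eqb_spec => [->//|ne1]; case: Z.eqb_spec => [->//|ne2].
  by apply: Ak; lia.
pose Y := fix Y m := if m is m'.+1 then h (m', Y m') else (fun=> a).
have IY m : Inf m (Y m) by elim: m => //= m IH; apply: (Hh (m, Y m) IH).2.
have AY m d : agree_on m (Y (m + d)) (Y m).
  elim: d => [|d IH] i Hi; first by rewrite addn0.
  rewrite addnS -IH //; apply: (Hh (m + d, Y (m + d)) (IY _)).1 => /=; lia.
(* Later patterns agree with earlier ones, so cell [i] of the limit is read off from the pattern of
   radius [|i|]. *)
exists (fun i => Y (Z.abs_nat i) i) => m N; have [k le [Qk Ak]] := IY m N.
exists k => //; split=> // i Hi; rewrite Ak //.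
rewrite -(AY (Z.abs_nat i) (m - Z.abs_nat i)); last lia.
by rewrite subnKC //; lia.
Qed.

Lemma language_recurs (S : finType) (f : config S -> config S) u :
  language (asymptotic_set f) u <->
  exists x, forall N, exists2 k, N <= k & occurs u (iter k f x).
Proof.
split=> [[y [[x Hx] Hu]]|[x Hx]].
  exists x => N; have [k [le A]] := Hx N (size u); exists k => //.
  exact: occurs_agree A _.
have [y Hy] := konig (fun k => iter k f x) Hx; exists y; split.
  by exists x => n m; have [k le [_ A]] := Hy m n; exists k.
have [k _ [Ok A]] := Hy (size u) 0.
by apply: occurs_agree Ok => i Hi; rewrite A.
Qed.

Lemma word_code_inj (S : finType) : injective (@word_code S).
Proof.
have lt (a : S) : enum_rank a < #|S| by apply: ltn_ord.
elim=> [|a u IH] [|b v] //= /eqP; rewrite !addSn eqSS => /eqP E.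
have q0 : 0 < #|S| by apply: leq_ltn_trans (lt a).
have E1 : enum_rank a = enum_rank b :> nat.
  by have := congr1 (modn^~ #|S|) E; rewrite !(addnC (enum_rank _)) !(mulnC #|S|) !modnMDl !modn_small.
have /eqP := E; rewrite E1 eqn_add2l eqn_pmul2l // => /eqP /IH ->.
by congr (_ :: _); apply/enum_rank_inj/val_inj.
Qed.

Lemma Sigma11_trec Q H : trec 3 (fun C v => H C (nth 0 v 0) (nth 0 v 1) (nth 0 v 2)) ->
  (forall w, Q w <-> exists C, forall m, exists l, H C m l w = 0) -> Sigma11 Q.
Proof.
move=> [e He] HQ; have HE C m l w : reval C e [:: m; l; w] (H C m l w) by apply: (He C [:: m; l; w]).
exists e; split=> [C m l w|w]; first by exists (H C m l w).
rewrite HQ; split=> -[C HC]; exists C => m; have [l Hl] := HC m; exists l.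
  by rewrite -Hl.
exact: reval_det (HE C m l w) Hl.
Qed.

Lemma word_code_nseq (S : finType) n (a : S) u :
  word_code (nseq n a ++ u) = iteri n (fun _ x => (enum_rank a).+1 + #|S| * x) (word_code u).
Proof. by elim: n => //= n ->. Qed.

(** A sum of naturals vanishes iff all its terms do, and a product iff some factor does. *)
Lemma bounded_quantifiers_eq0 (F : nat -> nat -> nat) m l :
  \sum_(i < m.+1) \prod_(j < l.+1) F i j = 0 <->
  forall i, i <= m -> exists2 j, j <= l & F i j = 0.
Proof.
split=> [/eqP|H].
  rewrite sum_nat_eq0 => /forallP H i le; have := H (Ordinal (le : i < m.+1)) => /= /eqP H0.
  case: (classic (exists2 j, j <= l & F i j = 0)) => // Hn.
  suff : 0 < \prod_(j < l.+1) F i j by rewrite H0.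
  apply: prodn_gt0 => j; rewrite lt0n; apply/eqP => E; apply: Hn; exists j => //.
  by rewrite -ltnS ltn_ord.
apply/eqP; rewrite sum_nat_eq0; apply/forallP => i /=.
have [j lej E] := H i (ltn_ord i).
by rewrite (bigD1 (Ordinal (lej : j < l.+1))) //= E.
Qed.

Lemma wdata_ones K w k : k <> w.+1 -> wdata K w k = (false, [ffun=> true]).
Proof. by move=> /eqP/negPf ne; congr (_, _); apply/ffunP => i; rewrite !ffunE ne andbF. Qed.

Lemma wdata_last K w k : k = w.+1 -> wdata K w k = (false, [ffun i => i != ord0]).
Proof. by move=> ->; congr (_, _); apply/ffunP => i; rewrite !ffunE eqxx andbT. Qed.

Lemma window_eq P K w : window P K w =
  (true, inl (home_state P), (false, [ffun=> true])) ::
  nseq w (false, inr false, (false, [ffun=> true])) ++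
  [:: (false, inr false, (false, [ffun i => i != ord0]))].
Proof.
have -> : window P K w = [seq cellat (0, home_state P, wdata K w) k | k <- 0 :: iota 1 w ++ [:: w.+1]].
  by rewrite /window; congr map; have := iotaD 1 w 1; rewrite addn1 [iota (1 + w) 1]/= add1n => <-.
rewrite map_cons map_cat [map _ [:: _]]/= {1 3}/cellat /= wdata_ones //.
rewrite (wdata_last _ (erefl w.+1)); congr (_ :: _).
congr (_ ++ _); apply: (@eq_from_nth _ (blank P K)); rewrite ?size_map ?size_iota ?size_nseq // => i lt.
rewrite (nth_map 0) ?size_iota // nth_iota // nth_nseq lt add1n /cellat /=.
by rewrite wdata_ones //; lia.
Qed.

Lemma Sigma11_reduces Q : Sigma11 Q ->
  exists (S : finType) (lo : S -> S -> S -> S), 0 < #|S| /\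
    many_one_reducible Q (languageN (asymptotic_set (ca lo))).
Proof.
move=> [e0 [Htot HQ]].
have [F0 HF0] : exists F0 : (nat -> bool) * nat * nat * nat -> nat, forall z,
    reval z.1.1.1 e0 [:: z.1.1.2; z.1.2; z.2] (F0 z).
  apply: (functional_choice (fun z r => reval z.1.1.1 e0 [:: z.1.1.2; z.1.2; z.2] r)).
  by move=> [[[C m] l] w].
pose F C m l w := F0 (C, m, l, w).
have HF C m l w : reval C e0 [:: m; l; w] (F C m l w) by apply: (HF0 (C, m, l, w)).
have TF : trec 3 (fun C v => F C (nth 0 v 0) (nth 0 v 1) (nth 0 v 2)).
  by exists e0 => C [|m [|l [|w []]]].
(* Zeros of [G] persist as [l] grows, as [tm_complete] demands. The machine stores [w + 1] in
   register 0, hence the predecessor. *)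
pose G C m l w := \sum_(i < m.+1) \prod_(j < l.+1) F C i j w.-1.
have [e He] : trec 3 (fun C v => G C (nth 0 v 0) (nth 0 v 1) (nth 0 v 2)).
  apply: (@trec_sum 3 _ (fun C i v => \prod_(j < (nth 0 v 1).+1) F C i j (nth 0 v 2).-1)).
    by apply: trec_succ; trec_leaf.
  apply: (@trec_prod 4 _ (fun C j w => F C (nth 0 w 0) j (nth 0 (behead w) 2).-1)).
    by apply: trec_succ; trec_leaf.
  apply: (trec_comp3 TF); [trec_leaf|trec_leaf|apply: trec_pred; trec_leaf].
have HG w C m l : reval C e [:: m; l; w.+1] (G C m l w.+1) by apply: (He C [:: m; l; w.+1]).
have [K0 HK0] := cok_exists (CCheck e).
pose K := 5 + K0; have HK : cok K (CCheck e) by apply: cokW HK0; apply: leq_addl.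
have K5 : 5 <= K by apply: leq_addr.
pose P := prog e K.
have Qrec w : Q w <-> exists2 tau, inf_often (tmwin w) ((0, home_state P, tau) : tmconf P K) &
    tmwin w ((0, home_state P, tau) : tmconf P K).
  rewrite HQ; split=> [[C HC]|[tau H1 H2]].
    have [m|tau Ht] := @tm_complete e K w (fun C m l => G C m l w.+1) K5 HK (HG w) C.
      have [L HL] : exists L : nat -> nat, forall m, F C m (L m) w = 0.
        apply: (functional_choice (fun m l => F C m l w = 0)) => m'.
        by have [l Hl] := HC m'; exists l; apply: reval_det (HF C m' l w) Hl.
      exists (\max_(i < m.+1) L i) => l le; apply/(bounded_quantifiers_eq0 (fun i j => F C i j w)) => i lei.
      exists (L i) => //; apply: leq_trans le.
      exact: (@leq_bigmax _ (fun i : 'I_m.+1 => L i) (Ordinal (lei : i < m.+1))).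
    (* The window is also wanted at time 0, so the tape is replaced by the one at some occurrence of
       the window. *)
    have [k _ Hk] := Ht 0; case Ek: (iter k (@tstep P K) (0, home_state P, tau)) => [[p q] tau1].
    exists tau1.
      move: (inf_often_iter k Ht); rewrite Ek.
      by move: Hk; rewrite Ek => -[/andP[/= /eqP -> /eqP ->] _].
    by move: Hk; rewrite Ek => -[_ Hd]; split; rewrite // /home /= eqxx.
  have [C HC] := @tm_sound e K w (fun C m l => G C m l w.+1) K5 HK (HG w) tau H1 H2.
  exists C => d; have [m [l [le /(bounded_quantifiers_eq0 (fun i j => F C i j w)) /(_ d le) [j _ E]]]] := HC d.
  by exists j; rewrite -E.
exists (cell P K : finType), (@loc P K); split.
  by apply/card_gt0P; exists (blank P K).
exists (fun w => word_code (window P K w)); split.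
  apply: trec_computable.
  pose d0 := (enum_rank ((true, inl (home_state P), (false, [ffun=> true])) : cell P K)).+1.
  pose d1 := (enum_rank ((false, inr false, (false, [ffun=> true])) : cell P K)).+1.
  pose d2 := (enum_rank ((false, inr false, (false, [ffun i => i != ord0])) : cell P K)).+1.
  apply: (@trec_ext _ (fun _ v => d0 + #|{: cell P K}| * iteri (nth 0 v 0)
     (fun _ x => d1 + #|{: cell P K}| * x) (d2 + #|{: cell P K}| * 0))).
    by move=> _ v _; rewrite window_eq /= word_code_nseq.
  apply: trec_add; first trec_leaf.
  apply: trec_mul; first trec_leaf.
  apply: (@trec_iteri _ _ _ (fun _ _ x _ => d1 + #|{: cell P K}| * x)); try trec_leaf.
  by apply: trec_add; [trec_leaf|apply: trec_mul; trec_leaf].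
move=> w; rewrite Qrec -ca_window_recurs.
have Hocc (x : config (cell P K)) : (forall i, i < w.+2 ->
    x (Z.of_nat i) = cellat (0, home_state P, wdata K w) i) <-> occurs (window P K w) x.
  rewrite /occurs size_map size_iota /window; split=> [H|/eq_in_map H i lt].
    by apply/eq_in_map => i; rewrite mem_iota => lt; rewrite H.
  by rewrite H // mem_iota.
split=> [[x Hx]|[u [/word_code_inj -> /language_recurs [x Hx]]]].
  exists (window P K w); split=> //; apply/language_recurs; exists x => N.
  by have [k le /Hocc Hk] := Hx N; exists k.
by exists x => N; have [k le /Hocc Hk] := Hx N; exists k.
Qed.

(** * Upper bound and universality *)


Definition nsum n (F : nat -> nat) := \sum_(i < n) F i.

Lemma trec_nsum n N F : trec n N -> trec n.+1 (fun C w => F C (nth 0 w 0) (behead w)) ->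
  trec n (fun C v => nsum (N C v) (fun i => F C i v)).
Proof. exact: trec_sum. Qed.

Definition digit q r i := (r %/ q ^ i) %% q.

(** A base-[q] numeral, least significant digit first; with digits from 1 to [q] it is the bijective
    numeration of [word_code]. *)
Definition mkrow q n (F : nat -> nat) := nsum n (fun i => F i * q ^ i).

Lemma mkrowS q n F : mkrow q n.+1 F = F 0 + q * mkrow q n (fun i => F i.+1).
Proof.
rewrite /mkrow /nsum big_ord_recl muln1 big_distrr; congr (_ + _).
by apply: eq_bigr => i _; rewrite /= expnS mulnCA.
Qed.

Lemma digit_mkrow q n F i : (forall k, k < n -> F k < q) -> i < n ->
  digit q (mkrow q n F) i = F i.
Proof.
elim: n F i => // n IH F i HF lt.
have q0 : 0 < q by apply: leq_ltn_trans (HF 0 isT).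
rewrite mkrowS addnC mulnC /digit; case: i lt => [|i] lt.
  by rewrite expn0 divn1 modnMDl modn_small ?HF.
by rewrite expnS divnMA divnMDl // (divn_small (HF 0 isT)) addn0 -/(digit _ _ _) IH // => k ltk; apply: HF.
Qed.

Lemma trec_digit n Q R I : trec n Q -> trec n R -> trec n I ->
  trec n (fun C v => digit (Q C v) (R C v) (I C v)).
Proof. by move=> HQ HR HI; apply: trec_mod => //; apply: trec_div => //; apply: trec_exp. Qed.

Lemma trec_mkrow n Q N F : trec n.+1 (fun C w => Q C (behead w)) -> trec n N ->
  trec n.+1 (fun C w => F C (nth 0 w 0) (behead w)) ->
  trec n (fun C v => mkrow (Q C v) (N C v) (fun i => F C i v)).
Proof.
move=> HQ HN HF; apply: (@trec_nsum _ _ (fun C i v => F C i v * Q C v ^ i)) => //.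
by apply: trec_mul => //; apply: trec_exp => //; trec_leaf.
Qed.

(* The configuration coded by an oracle: the symbol of the cell numbered z is the number of
   elements among q z, ..., q z + q - 2; cell i - k of the bi-infinite line has number zig i k. *)
Definition oracle_symbol (C : nat -> bool) q z := nsum q.-1 (fun s => C (z * q + s)).
Definition zig i k := 2 * (i - k) + (2 * (k - i)).-1.
Definition first_row C q k n := mkrow q n (fun i => oracle_symbol C q (zig i k)).
(** Cell [i] depends on the old cells [i] to [i + 2], so the row drifts by one position per step.
    The length [n] is kept, and the meaningless part at the right end grows by two cells per step.
    Hence [row] starts with [2 * k + j] cells, from position [-k] on. *)
Definition next_row q T n r :=
  mkrow q n (fun i => digit q T ((digit q r i * q + digit q r i.+1) * q + digit q r i.+2)).
Definition row C q T k j := iteri k (fun _ r => next_row q T (2 * k + j) r) (first_row C q k (2 * k + j)).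
Definition row_code C q T k j := mkrow q j (fun i => (digit q (row C q T k j) i).+1).

Lemma trec_row_code n Q T Kf J : trec n Q -> trec n T -> trec n Kf -> trec n J ->
  trec n (fun C v => row_code C (Q C v) (T C v) (Kf C v) (J C v)).
Proof.
move=> HQ HT HK HJ.
suff H : trec 4 (fun C v => row_code C (nth 0 v 0) (nth 0 v 1) (nth 0 v 2) (nth 0 v 3)).
  exact: (@trec_comp n _ [:: Q; T; Kf; J] H).
have HR : trec 4 (fun C v => row C (nth 0 v 0) (nth 0 v 1) (nth 0 v 2) (nth 0 v 3)).
  apply: (@trec_iteri _ _ _ (fun _ _ r v =>
     next_row (nth 0 v 0) (nth 0 v 1) (2 * nth 0 v 2 + nth 0 v 3) r)); first trec_leaf.
    apply: trec_mkrow; first trec_leaf.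
      by apply: trec_add; [apply: trec_mul|]; trec_leaf.
    apply: trec_nsum; first by apply: trec_pred; trec_leaf.
    apply: trec_oracle; apply: trec_add; last trec_leaf.
    apply: trec_mul; last trec_leaf.
    apply: trec_add; [|apply: trec_pred]; apply: trec_mul; try trec_leaf; apply: trec_sub; trec_leaf.
  apply: trec_mkrow; first trec_leaf.
    by apply: trec_add; [apply: trec_mul|]; trec_leaf.
  apply: trec_digit; [trec_leaf|trec_leaf|].
  apply: trec_add; last by apply: trec_digit; try apply: trec_succ; try apply: trec_succ; trec_leaf.
  apply: trec_mul; last trec_leaf.
  apply: trec_add; last by apply: trec_digit; try apply: trec_succ; trec_leaf.
  apply: trec_mul; last trec_leaf.
  by apply: trec_digit; trec_leaf.
have HR' : trec 5 (fun C w => row C (nth 0 (behead w) 0) (nth 0 (behead w) 1)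
    (nth 0 (behead w) 2) (nth 0 (behead w) 3)).
  apply: (@trec_comp 5 (fun C v => row C (nth 0 v 0) (nth 0 v 1) (nth 0 v 2) (nth 0 v 3))
    [:: (fun _ w => nth 0 (behead w) 0); (fun _ w => nth 0 (behead w) 1);
        (fun _ w => nth 0 (behead w) 2); (fun _ w => nth 0 (behead w) 3)]) => //.
  by do !split; trec_leaf.
apply: (@trec_mkrow _ _ _ (fun C i v => (digit (nth 0 v 0)
   (row C (nth 0 v 0) (nth 0 v 1) (nth 0 v 2) (nth 0 v 3)) i).+1)); [trec_leaf|trec_leaf|].
by apply: trec_succ; apply: trec_digit; trec_leaf.
Qed.

(** The witness [l] pairs a delay with a word length, so [m + cfst l] is an arbitrary time not
    before [m]. The result is the absolute difference of [x] and [c]. *)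
Definition ca_check C m l q T c :=
  let x := row_code C q T (m + cfst l) (csnd l) in (x - c) + (c - x).

Lemma trec_ca_check n M L Q T Cd : trec n M -> trec n L -> trec n Q -> trec n T -> trec n Cd ->
  trec n (fun C v => ca_check C (M C v) (L C v) (Q C v) (T C v) (Cd C v)).
Proof.
move=> HM HL HQ HT HC.
have HR : trec n (fun C v => row_code C (Q C v) (T C v) (M C v + cfst (L C v)) (csnd (L C v))).
  apply: trec_row_code => //; last exact: trec_csnd.
  by apply: trec_add => //; apply: trec_cfst.
by apply: trec_add; apply: trec_sub.
Qed.

(** * Coding configurations by oracles and local rules by numbers *)

Definition zigz (z : Z) : nat :=
  if (0 <=? z)%Z then 2 * Z.to_nat z else (2 * Z.to_nat (- z)).-1.
Definition zag (n : nat) : Z :=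
  if odd n then (- Z.of_nat n.+1./2)%Z else Z.of_nat n./2.

Lemma zigzK z : zag (zigz z) = z.
Proof.
rewrite /zigz /zag; case: Z.leb_spec => lt.
  by rewrite mul2n odd_double doubleK; lia.
have -> : (2 * Z.to_nat (- z)).-1 = (Z.to_nat (- z)).-1.*2.+1 by lia.
by rewrite /= odd_double /= doubleK; lia.
Qed.

Lemma zig_zigz i k : zig i k = zigz (Z.of_nat i - Z.of_nat k).
Proof. by rewrite /zig /zigz; case: Z.leb_spec; lia. Qed.

Section UpperBound.
Variables (S : finType) (lo : S -> S -> S -> S).
Hypothesis S0 : 0 < #|S|.
Notation q := #|S|.
Notation rank a := (nat_of_ord (enum_rank a)).

Definition triple_code (t : S * S * S) := (rank t.1.1 * q + rank t.1.2) * q + rank t.2.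

Definition rule_entry idx :=
  if [pick t | triple_code t == idx] is Some t then rank (lo t.1.1 t.1.2 t.2) else 0.

Definition rule_table := mkrow q (q ^ 3) rule_entry.

Lemma rank_lt (a : S) : rank a < q.
Proof. exact: ltn_ord. Qed.

Lemma digits_inj a b x y : a < q -> b < q -> x * q + a = y * q + b -> x = y /\ a = b.
Proof.
move=> la lb E; have Ea : a = b.
  by have := congr1 (modn^~ q) E; rewrite !modnMDl !modn_small.
split=> //; move: E; rewrite Ea => /eqP; rewrite eqn_add2r eqn_pmul2r // => /eqP; exact.
Qed.

Lemma triple_code_inj : injective triple_code.
Proof.
move=> [[a b] c] [[a' b'] c'] /(digits_inj (rank_lt c) (rank_lt c')) [] /=.
move=> /(digits_inj (rank_lt b) (rank_lt b')) [E1 E2] E3.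
by congr (_, _, _); apply/enum_rank_inj/val_inj.
Qed.

Lemma digit_rule_table a b c :
  digit q rule_table ((rank a * q + rank b) * q + rank c) = rank (lo a b c).
Proof.
rewrite /rule_table digit_mkrow.
- rewrite /rule_entry; case: pickP => [t /eqP|/(_ (a, b, c))]; last by rewrite eqxx.
  by rewrite -[RHS]/(triple_code (a, b, c)) => /triple_code_inj ->.
- by move=> k _; rewrite /rule_entry; case: pickP => // t _; apply: rank_lt.
- have := (rank_lt a, rank_lt b, rank_lt c); rewrite !expnS expn0 => -[[]]; nia.
Qed.

Lemma word_code_mkrow (y : nat -> S) s j :
  word_code [seq y i | i <- iota s j] = mkrow q j (fun i => (rank (y (s + i))).+1).
Proof.
elim: j s => [|j IH] s; first by rewrite /mkrow /nsum big_ord0.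
rewrite mkrowS /= IH addn0; congr (_ + q * _).
by rewrite /mkrow /nsum; apply: eq_bigr => i _; rewrite addSnnS.
Qed.

Section OracleConfig.
Variables (C : nat -> bool) (x : config S).
Hypothesis HCx : forall z, rank (x z) = oracle_symbol C q (zigz z).

Lemma digit_row k j t i : t <= k -> i + 2 * t < 2 * k + j ->
  digit q (iteri t (fun _ r => next_row q rule_table (2 * k + j) r)
     (first_row C q k (2 * k + j))) i =
  rank (iter t (ca lo) x (Z.of_nat i - Z.of_nat k + Z.of_nat t)%Z).
Proof.
elim: t i => [|t IH] i letk lti.
  rewrite /= /first_row digit_mkrow; [|by move=> n _; rewrite zig_zigz -HCx rank_lt|lia].
  by rewrite zig_zigz -HCx; congr (rank (x _)); lia.
rewrite iteriS {1}/next_row digit_mkrow; last lia.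
  rewrite !IH; try lia.
  rewrite digit_rule_table iterS {1}/ca; congr (rank (lo _ _ _)); apply: (f_equal (iter t (ca lo) x)); lia.
by move=> n _; apply: ltn_pmod.
Qed.

Lemma row_code_word k j : row_code C q rule_table k j =
  word_code [seq iter k (ca lo) x (Z.of_nat i) | i <- iota 0 j].
Proof.
rewrite (word_code_mkrow (fun i => iter k (ca lo) x (Z.of_nat i))) /row_code /mkrow /nsum.
apply: eq_bigr => i _; rewrite /row digit_row //; last by have := ltn_ord i; lia.
rewrite add0n; congr ((rank _).+1 * _); apply: (f_equal (iter k (ca lo) x)); lia.
Qed.

End OracleConfig.

Lemma oracle_of_config (x : config S) : exists C, forall z,
  rank (x z) = oracle_symbol C q (zigz z).
Proof.
(* Block [z] of [q] oracle bits writes the rank of the symbol in unary. *)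
exists (fun n => n %% q < rank (x (zag (n %/ q)))) => z; rewrite /oracle_symbol /nsum.
have := rank_lt (x z) => lt.
rewrite -[LHS](@sum_ltn q.-1); last lia.
apply: eq_bigr => s _; have lts : s < q by have := ltn_ord s; lia.
by rewrite modnMDl modn_small // divnMDl // divn_small // addn0 zigzK.
Qed.

(** A sum of [q - 1] bits is below [q], so every oracle codes a configuration and the quantifier
    over oracles requires no validity test. *)
Lemma config_of_oracle C : exists x : config S, forall z,
  rank (x z) = oracle_symbol C q (zigz z).
Proof.
have lt z : oracle_symbol C q z < q.
  apply: (@leq_ltn_trans (\sum_(i < q.-1) 1)); last by rewrite sum1_card card_ord; lia.
  by apply: leq_sum => i _; case: (C _).
by exists (fun z => enum_val (Ordinal (lt (zigz z)))) => z; rewrite enum_valK.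
Qed.

Lemma languageN_ca_check c : languageN (asymptotic_set (ca lo)) c <->
  exists C, forall m, exists l, ca_check C m l q rule_table c = 0.
Proof.
have chk C m l : ca_check C m l q rule_table c = 0 <->
    row_code C q rule_table (m + cfst l) (csnd l) = c by rewrite /ca_check; lia.
split=> [[u [<- /language_recurs [x Hx]]]|[C HC]].
  have [C HCx] := oracle_of_config x; exists C => m; have [k le Hk] := Hx m.
  exists (cpair (k - m) (size u)); rewrite /ca_check (row_code_word HCx).
  by rewrite cfst_cpair csnd_cpair subnKC // -Hk subnn.
have [x Hx] := config_of_oracle C.
have {}HC m : exists k j, m <= k /\ word_code [seq iter k (ca lo) x (Z.of_nat i) | i <- iota 0 j] = c.
  have [l /chk Hl] := HC m; exists (m + cfst l), (csnd l).
  by rewrite -(row_code_word Hx) leq_addr.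
have [k0 [j0 [_ E0]]] := HC 0; eexists; split; first exact: E0.
apply/language_recurs; exists x => N; have [k [j [le E]]] := HC N; exists k => //.
(* The length [j] might vary with the time, but the code [c] determines the word and hence its
   length. *)
have Ew := word_code_inj (etrans E (esym E0)).
by rewrite /occurs -Ew size_map size_iota.
Qed.

Lemma Sigma11_languageN_ca : Sigma11 (languageN (asymptotic_set (ca lo))).
Proof.
apply: (@Sigma11_trec _ (fun C m l c => ca_check C m l q rule_table c)).
  by apply: trec_ca_check; trec_leaf.
exact: languageN_ca_check.
Qed.

End UpperBound.

(** The components of [n] are an alphabet size, a rule table and a word code, so the languages of
    all radius-1 automata appear as sections of one set. *)
Definition universal_set n := exists C, forall m, exists l,
  ca_check C m l (cfst n) (cfst (csnd n)) (csnd (csnd n)) = 0.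

Lemma Sigma11_universal : Sigma11 universal_set.
Proof.
apply: (@Sigma11_trec _ (fun C m l n => ca_check C m l (cfst n) (cfst (csnd n)) (csnd (csnd n)))) => //.
apply: trec_ca_check; try trec_leaf; try apply: trec_cfst; try apply: trec_csnd;
  try apply: trec_csnd; trec_leaf.
Qed.

Lemma universal_hard Q : Sigma11 Q -> many_one_reducible Q universal_set.
Proof.
move=> /Sigma11_reduces [S [lo [S0 red]]]; apply: many_one_trans red _.
exists (fun c => cpair #|S| (cpair (rule_table lo) c)); split.
  by apply: trec_computable; apply: trec_cpair; [|apply: trec_cpair]; trec_leaf.
move=> c; rewrite (languageN_ca_check lo S0) /universal_set.
by rewrite !(cfst_cpair, csnd_cpair).
Qed.

Theorem theorem1 :
  (forall P : nat -> Prop, Sigma11 P ->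
     exists (S : finType) (f : config S -> config S),
       0 < #|S| /\ cellular_automaton f /\
       many_one_reducible P (languageN (asymptotic_set f))) /\
  (exists (S : finType) (f : config S -> config S),
       0 < #|S| /\ cellular_automaton f /\
       Sigma11_complete (languageN (asymptotic_set f))).
Proof.
split=> [P /Sigma11_reduces [S [lo [S0 red]]]|].
  by exists S, (ca lo); split=> //; split=> //; apply: ca_cellular_automaton.
have [S [lo [S0 red]]] := Sigma11_reduces Sigma11_universal.
exists S, (ca lo); split=> //; split; first exact: ca_cellular_automaton.
split; first exact: Sigma11_languageN_ca.
by move=> Q /universal_hard H; apply: many_one_trans H red.
Qed.
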